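(* Consider $\mathbf{\Omega}=(\omega_{ij})\in\mathbb{R}^{n\times l}$ as a standardized Bernoulli matrix with parameter $p\in(0,1)$. Let $\mathbf{U}=(u_{ij})\in\mathbb{R}^{n\times n}$ be an orthogonal matrix satisfying the condition $$\max_{i,j=1,\dots,n}|u_{ij}|\le\varepsilon_n,\qquad\text{where }\varepsilon_n\to0\text{ as }n\to\infty.$$ Then $\mathbf{U}\mathbf{\Omega}$ converges in distribution to a standard Gaussian matrix as $n\to\infty$. Furthermore, the Kolmogorov distance between the distribution of each element $(\mathbf{U}\mathbf{\Omega})_{ij}$ of $\mathbf{U}\mathbf{\Omega}$ and the standard normal distribution $\phi(x)$ is given by $$\sup_{x}\bigl|\mathbb{P}\bigl((\mathbf{U}\mathbf{\Omega})_{ij}\le x\bigr)-\phi(x)\bigr|=O\Bigl(\sum_{k=1}^{n}|u_{ik}|^3\Bigr).$$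
   Context: All matrices are real. A Bernoulli matrix with parameter $p\in(0,1)$ is a matrix $\mathbf{B}=(b_{ij})\in\mathbb{R}^{n\times l}$ whose entries are i.i.d. with $\mathbb{P}(b_{ij}=1)=p$, $\mathbb{P}(b_{ij}=0)=1-p$. The standardized Bernoulli matrix with parameter $p$ is $\mathbf{\Omega}=(\omega_{ij})\in\mathbb{R}^{n\times l}$ with $\omega_{ij}=(b_{ij}-p)/\sqrt{p(1-p)}$. A standard Gaussian matrix is a matrix with i.i.d. standard normal entries. $\phi(x)$ denotes the distribution function of the standard normal distribution. *)

(* Defs.v *)
From HB Require Import structures.
From mathcomp Require Import all_boot all_order all_algebra.
From mathcomp Require Import all_classical all_reals all_analysis.

Set Implicit Arguments.
Unset Strict Implicit.
Unset Printing Implicit Defensive.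

Import Order.TTheory GRing.Theory Num.Theory.
Import numFieldNormedType.Exports.

Local Open Scope classical_set_scope.
Local Open Scope ring_scope.

(* The factors A i with i outside J are irrelevant, so letting J range over all
   subsets of I states the product rule for every finite subfamily. *)
Definition mutually_independent d (T : measurableType d) (R : realType)
    (P : probability T R) (I : finType) (X : I -> T -> R) : Prop :=
  forall (J : {set I}) (A : I -> set R), (forall i, measurable (A i)) ->
    P [set t | forall i, i \in J -> A i (X i t)] =
    (\prod_(i in J) P (X i @^-1` A i))%E.

Definition random_matrix d (T : measurableType d) (R : realType) (m l : nat)
    (X : T -> 'M[R]_(m, l)) : Prop :=
  forall i j, measurable_fun [set: T] (fun t => X t i j).

Definition independent_entries d (T : measurableType d) (R : realType)
    (P : probability T R) (m l : nat) (X : T -> 'M[R]_(m, l)) : Prop :=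
  mutually_independent P (fun (ij : 'I_m * 'I_l) t => X t ij.1 ij.2).

Definition bernoulli_matrix d (T : measurableType d) (R : realType)
    (P : probability T R) (p : R) (m l : nat) (B : T -> 'M[R]_(m, l)) : Prop :=
  [/\ random_matrix B,
      independent_entries P B,
      forall i j, P [set t | B t i j = 1] = p%:E &
      forall i j, P [set t | B t i j = 0] = (1 - p)%:E].

Definition standardized_bernoulli_matrix d (T : measurableType d)
    (R : realType) (P : probability T R) (p : R) (m l : nat)
    (Om : T -> 'M[R]_(m, l)) : Prop :=
  exists2 B : T -> 'M[R]_(m, l), bernoulli_matrix P p B &
    forall t i j, Om t i j = (B t i j - p) / Num.sqrt (p * (1 - p)).

Definition standard_gaussian_matrix d (T : measurableType d) (R : realType)
    (P : probability T R) (m l : nat) (Z : T -> 'M[R]_(m, l)) : Prop :=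
  [/\ random_matrix Z,
      independent_entries P Z &
      forall i j (A : set R), measurable A ->
        P [set t | A (Z t i j)] = normal_prob 0 1 A].

(* Convergence in distribution of random matrices of a fixed size, tested
   against bounded continuous functions; each X n may live on its own
   probability space. *)
Definition cvg_in_distribution (R : realType) (m l : nat)
    (d : nat -> measure_display) (T : forall n, measurableType (d n))
    (P : forall n, probability (T n) R) (X : forall n, T n -> 'M[R]_(m, l))
    d' (S : measurableType d') (Q : probability S R)
    (Z : S -> 'M[R]_(m, l)) : Prop :=
  forall g : 'M[R]_(m, l) -> R,
    continuous g -> (exists M : R, forall A, `|g A| <= M) ->
    (fun n => 'E_(P n)[g \o X n])%E @ \oo --> ('E_Q[g \o Z])%E.

(* The sizes of the matrices X n grow with n, so that there is no fixed space
   in which to take the limit: convergence to a standard Gaussian matrix is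
   convergence of the finite-dimensional distributions.  Any fixed number r of
   distinct rows may be selected, in any order and depending on n; when
   n.+1 < r no injective selection exists, hence the "eventually". *)
Definition cvg_to_standard_gaussian (R : realType) (l : nat)
    (d : nat -> measure_display) (T : forall n, measurableType (d n))
    (P : forall n, probability (T n) R)
    (X : forall n, T n -> 'M[R]_(n.+1, l)) : Prop :=
  forall (r : nat) (rho : forall n, 'I_r -> 'I_n.+1),
    (\forall n \near \oo, injective (rho n)) ->
  forall d' (S : measurableType d') (Q : probability S R)
    (Z : S -> 'M[R]_(r, l)), standard_gaussian_matrix Q Z ->
    cvg_in_distribution P (fun n t => rowsub (rho n) (X n t)) Q Z.

Definition orthogonal_matrix (R : realType) (n : nat) (U : 'M[R]_n) : Prop :=
  U^T *m U = 1%:M.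

Definition std_normal_cdf (R : realType) (x : R) : \bar R :=
  normal_prob 0 1 `]-oo, x].

Definition kolmogorov_distance (R : realType) (F G : R -> \bar R) : \bar R :=
  ereal_sup [set `|F x - G x|%E | x in [set: R]].

(* Main.v *)
(* Write W for a linear form in the standardized Bernoulli variables with unit
   coefficient vector u, and let f solve Stein's equation
   f'(w) - w f(w) = 1(w <= x) - Phi(x).  For a two-point variable, E[om_k F] is
   exactly sqrt(p(1-p)) times the mean increment of F when the k-th variable is
   flipped, so E[W f(W)] is a sum of increments of f, each close to
   u_k^2 E f'(W); the jump of f' at x is controlled by a concentration inequality
   for W.  This gives the rate \sum_k |u_k|^3.

   The same computation with an extra factor G, a product of smooth functions of
   linear forms orthogonal to u, gives
   E[(1(W <= x) - Phi(x)) G] -> 0, because the first-order contributions of the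
   increments of G cancel by orthogonality.  By induction on the number of
   factors, expectations of products of one-variable test functions of the entries
   of U Om converge to the Gaussian ones.  Products of B-splines form partitions
   of unity, so these products approximate every bounded continuous function of
   the matrix uniformly on compact sets, and their total mass controls the tails. *)

Require Import Defs.
From HB Require Import structures.
From mathcomp Require Import all_boot all_order all_algebra.
From mathcomp Require Import all_classical all_reals all_analysis.
From mathcomp Require Import measurable_realfun.
From mathcomp Require Import ring lra.

Set Implicit Arguments.
Unset Strict Implicit.
Unset Printing Implicit Defensive.

Import Order.TTheory GRing.Theory Num.Theory.
Import numFieldNormedType.Exports.

Local Open Scope classical_set_scope.
Local Open Scope ring_scope.

(** * The normal distribution function and Stein's equation *)

(** The quantitative part lives on a finite cube of outcomes, where an expectation is a weighted
    sum; measure theory enters only when laws are transferred. The index type of the cube is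
    arbitrary and no constant depends on it, so the entries of [Om] can be indexed by pairs and the
    bounds are uniform in the size of the matrix. The obstacle is that Stein's equation is solved
    for half-line indicators only, whose solutions have a discontinuous derivative, whereas the
    cancellation by orthogonality needs weights with a second-order expansion. Hence the two roles
    of a test function: it is smooth while it serves as a weight, and it is approximated uniformly
    by step functions when its turn comes to be replaced by its Gaussian mean. Uniform approximation
    passes to the means, so no Gaussian integral of a test function is ever computed. *)

Section gaussian.
Context {R : realType}.
Implicit Types (u v w x y a b : R).

Lemma mvt_segment (f df : R -> R) a b : a < b ->
  (forall y, a <= y <= b -> is_derive y 1 f (df y)) ->
  exists2 c, a <= c <= b & f b - f a = df c * (b - a).
Proof.
move=> ab fdf; have [||c cab ->] := @MVT_segment _ f df _ _ (ltW ab).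
- by move=> y; rewrite in_itv/= => /andP[? ?]; apply: fdf; rewrite !ltW.
- apply: derivable_within_continuous => y; rewrite in_itv/= => yab.
  by have [] := fdf _ yab.
- by exists c => //; move: cab; rewrite in_itv.
Qed.

Local Notation gpdf := (@normal_pdf R 0 1).

Lemma gpdfE y : gpdf y = normal_peak 1 * expR (- (y ^+ 2 / 2)).
Proof.
by rewrite normal_pdfE ?oner_neq0// /normal_fun subr0 expr1n mulNr.
Qed.

Lemma gpdf_gt0 y : 0 < gpdf y.
Proof. by rewrite gpdfE mulr_gt0 ?expR_gt0// normal_peak_gt0 ?oner_neq0. Qed.

Lemma gpdf_le u v : `|u| <= `|v| -> gpdf v <= gpdf u.
Proof.
move=> uv; rewrite !gpdfE ler_pM2l ?normal_peak_gt0 ?oner_neq0//.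
rewrite ler_expR lerN2 ler_pM2r// -real_normK ?num_real//.
by rewrite -[leRHS]real_normK ?num_real// lerXn2r// nnegrE.
Qed.

Lemma is_derive_gpdf y : is_derive y 1 gpdf (- y * gpdf y).
Proof.
have -> : gpdf = fun z => normal_peak 1 * (expR \o (fun z => - (z ^+ 2 / 2))) z.
  by apply/funext => z; exact: gpdfE.
have d1 : is_derive y 1 (fun z : R => - (z ^+ 2 / 2)) (- y).
  by apply: is_derive_eq; rewrite /GRing.scale/=; field.
have d2 := @is_derive1_comp _ expR _ _ _ _ (is_derive_expR _) d1.
apply: (is_derive_eq (is_deriveM (is_derive_cst (normal_peak 1) y 1) d2)).
by rewrite /GRing.scale/=; ring.
Qed.

Definition Phi x : R := fine (@std_normal_cdf R x).

Lemma PhiE x : std_normal_cdf x = (Phi x)%:E.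
Proof. by rewrite /Phi fineK// fin_num_measure. Qed.

Lemma is_derive_Phi x : is_derive x 1 Phi (gpdf x).
Proof.
have /= [||||dx Ex] := @continuous_FTC1 R gpdf (BInfty R true) x (x + 1).
- by rewrite ltrDl.
- apply: (@integrableS _ _ _ _ setT) => //.
  exact: integrable_normal_pdf.
- by rewrite ltNyr.
- by apply: continuous_normal_pdf; rewrite oner_neq0.
have -> : Phi = fun x => (\int[lebesgue_measure]_(t in `]-oo, x]) gpdf t)%R.
  by [].
by apply: DeriveDef => //; rewrite -derive1E.
Qed.

Lemma Phi_ge0 x : 0 <= Phi x.
Proof. by rewrite -lee_fin -PhiE; exact: measure_ge0. Qed.

Lemma Phi_le1 x : Phi x <= 1.
Proof. by rewrite -lee_fin -PhiE; exact: probability_le1. Qed.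

Lemma Phi_homo u v : u <= v -> Phi u <= Phi v.
Proof.
move=> uv; rewrite -lee_fin -!PhiE.
by rewrite /std_normal_cdf le_measure ?inE//; exact: subitvPr.
Qed.

(** The identity as a random variable on the normal probability space has distribution function
    [Phi], so the general limits of distribution functions at infinity apply to [Phi]. *)
Let idTR : measurableTypeR R -> R := idfun.

#[local] HB.instance Definition _ :=
  @isMeasurableFun.Build _ _ _ _ idTR (@measurable_id _ _ setT).

Lemma Phi_right e : 0 < e -> \forall y \near +oo, 1 - Phi y < e.
Proof.
move=> e0.
have /fine_cvgP[_] := @cvg_cdfy1 _ _ _ _ (idTR : {RV normal_prob 0 1 >-> R}).
move=> /cvgrPdist_lt/(_ _ e0).
apply: filterS => y /=; apply: le_lt_trans; exact: ler_norm.
Qed.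

Lemma Phi_left e : 0 < e -> \forall y \near -oo, Phi y < e.
Proof.
move=> e0.
have /fine_cvgP[_] := @cvg_cdfNy0 _ _ _ _ (idTR : {RV normal_prob 0 1 >-> R}).
move=> /cvgrPdist_lt/(_ _ e0).
apply: filterS => y /=; rewrite sub0r normrN; apply: le_lt_trans; exact: ler_norm.
Qed.

Lemma is_derive_gpdf_div y : y != 0 ->
  is_derive y 1 (fun z => gpdf z / z) (- gpdf y - gpdf y / y ^+ 2).
Proof.
move=> y0.
have dV : is_derive y 1 (fun z : R => z^-1) (- y ^- 2 *: 1).
  exact: (@is_deriveV _ id).
apply: (is_derive_eq (is_deriveM (is_derive_gpdf y) dV)).
by rewrite /GRing.scale/=; field.
Qed.

(** The function [gpdf z / z + Phi z] has derivative [- gpdf z / z ^ 2], hence decreases on the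
    positive half-line; it is compared at [w] and at a point [y] so far out that [1 - Phi y < e]. *)
Lemma mills_right w : 0 < w -> w * (1 - Phi w) <= gpdf w.
Proof.
move=> w0; rewrite mulrC -ler_pdivlMr//; apply/ler_addgt0Pr => e e0.
have [y [wy ye]] : exists y, w < y /\ 1 - Phi y < e.
  near (+oo_R) => y; exists y; split; first by near: y; apply: nbhs_pinfty_gt; rewrite num_real.
  by near: y; exact: Phi_right.
have [|c /andP[wc _]] := @mvt_segment (fun z => gpdf z / z + Phi z)
    (fun z => - (gpdf z / z ^+ 2)) w y wy.
  move=> z /andP[wz _].
  have z0 : z != 0 by rewrite gt_eqF// (lt_le_trans w0).
  apply: (is_derive_eq (is_deriveD (is_derive_gpdf_div z0) (is_derive_Phi z))).
  by ring.
have : 0 <= gpdf c / c ^+ 2 * (y - w).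
  by rewrite mulr_ge0 ?divr_ge0 ?sqr_ge0 ?(ltW (gpdf_gt0 _))// subr_ge0 ltW.
have : 0 <= gpdf y / y by rewrite divr_ge0 ?(ltW (gpdf_gt0 _))// ltW// (lt_trans w0).
lra.
Unshelve. all: by end_near. Qed.

Lemma mills_left w : w < 0 -> - w * Phi w <= gpdf w.
Proof.
move=> w0; have w0' : 0 < - w by rewrite oppr_gt0.
rewrite mulrC -ler_pdivlMr//; apply/ler_addgt0Pr => e e0.
have [y [wy ye]] : exists y, y < w /\ Phi y < e.
  near (-oo_R) => y; exists y; split; first by near: y; apply: nbhs_ninfty_lt; rewrite num_real.
  by near: y; exact: Phi_left.
have [|c /andP[_ wc]] := @mvt_segment (fun z => gpdf z / z + Phi z)
    (fun z => - (gpdf z / z ^+ 2)) y w wy.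
  move=> z /andP[_ wz].
  have z0 : z != 0 by rewrite lt_eqF// (le_lt_trans _ w0).
  apply: (is_derive_eq (is_deriveD (is_derive_gpdf_div z0) (is_derive_Phi z))).
  by ring.
have : 0 <= gpdf c / c ^+ 2 * (w - y).
  by rewrite mulr_ge0 ?divr_ge0 ?sqr_ge0 ?(ltW (gpdf_gt0 _))// subr_ge0 ltW.
have : gpdf y / y <= 0.
  by rewrite mulr_ge0_le0 ?(ltW (gpdf_gt0 _))// invr_le0 ltW// (lt_trans wy).
rewrite invrN; lra.
Unshelve. all: by end_near. Qed.

End gaussian.

(** * Bounds and increments of the solution of Stein's equation *)

Section stein_solution.
Context {R : realType}.
Implicit Types (u v w x y a b : R).
Local Notation gpdf := (@normal_pdf R 0 1).

(* Stein's bounded solution of [f' w - w * f w = (w <= x)%R%:R - Phi x]. *)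
Definition stein x w : R :=
  Phi (Num.min w x) * (1 - Phi (Num.max w x)) / gpdf w.

(** Not optimal: 1 bounds [stein] where [1 <= |w|], by [stein_mul], and the inverse of the least
    density on [[-1, 1]] bounds it elsewhere. *)
Definition stein_bound : R := 1 + (gpdf 1)^-1.

Lemma stein_bound_ge0 : 0 <= stein_bound.
Proof. by rewrite addr_ge0 ?invr_ge0 ?(ltW (gpdf_gt0 _)). Qed.

Lemma stein_ge0 x w : 0 <= stein x w.
Proof.
by rewrite divr_ge0 ?(ltW (gpdf_gt0 _))// mulr_ge0 ?Phi_ge0// subr_ge0 Phi_le1.
Qed.

(** The numerator of [stein x w] is at most both [Phi w] and [1 - Phi w]; the tail on the side of
    [w] is then controlled by the Mills inequality. *)
Lemma stein_mul x w : `|w| * stein x w <= 1.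
Proof.
rewrite /stein mulrA ler_pdivrMr ?gpdf_gt0// mul1r.
have P0 := Phi_ge0 (Num.min w x); have P1 := Phi_le1 (Num.max w x).
have Pm : Phi (Num.min w x) <= Phi w by apply: Phi_homo; rewrite ge_min lexx.
have PM : Phi w <= Phi (Num.max w x) by apply: Phi_homo; rewrite le_max lexx.
have P1' := Phi_le1 w.
have [w0|w0|->] := ltgtP w 0; last by rewrite normr0 mul0r ltW ?gpdf_gt0.
- rewrite ltr0_norm//; apply: le_trans (mills_left w0).
  rewrite ler_pM2l ?oppr_gt0//; nra.
- rewrite gtr0_norm//; apply: le_trans (mills_right w0).
  by rewrite ler_pM2l//; nra.
Qed.

Lemma stein_le x w : stein x w <= stein_bound.
Proof.
have := stein_mul x w; have := stein_ge0 x w => f0 fw.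
have g1 : 0 < (gpdf 1)^-1 by rewrite invr_gt0 gpdf_gt0.
have [w1|w1] := leP 1 `|w|.
  apply: (@le_trans _ _ 1); last by rewrite /stein_bound lerDl ltW.
  by nra.
apply: (@le_trans _ _ (gpdf 1)^-1); last by rewrite /stein_bound lerDr.
rewrite -[leRHS]mul1r ler_pM//.
- by rewrite mulr_ge0 ?Phi_ge0// subr_ge0 Phi_le1.
- by rewrite invr_ge0 ltW ?gpdf_gt0.
- have := Phi_ge0 (Num.min w x); have := Phi_le1 (Num.min w x).
  by have := Phi_ge0 (Num.max w x); have := Phi_le1 (Num.max w x); nra.
- by rewrite lef_pV2 ?posrE ?gpdf_gt0// gpdf_le// normr1 ltW.
Qed.

(** The inverse density is the integrating factor of Stein's equation: the second summand is [w]
    times the quotient itself. *)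
Lemma is_derive_div_gpdf (K : R -> R) k w : is_derive w 1 K k ->
  is_derive w 1 (fun z => K z / gpdf z) (k / gpdf w + w * (K w / gpdf w)).
Proof.
move=> dK.
have g0 : gpdf w != 0 by rewrite gt_eqF ?gpdf_gt0.
have dV := @is_deriveV _ _ _ _ _ g0 (is_derive_gpdf w).
apply: (is_derive_eq (is_deriveM dK dV)).
by rewrite /GRing.scale/=; field.
Qed.

Lemma stein_incr_left x a b lo hi : a <= b -> b <= x ->
  (forall t, a <= t <= b -> lo <= t * stein x t <= hi) ->
  lo * (b - a) <= stein x b - stein x a - (1 - Phi x) * (b - a) <= hi * (b - a).
Proof.
rewrite le_eqVlt => /predU1P[<- _ _|ab bx lohi].
  by rewrite !subrr !mulr0 subrr lexx.
pose F z := (1 - Phi x) * Phi z / gpdf z.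
have FE t : t <= x -> stein x t = F t.
  by move=> tx; rewrite /stein /F min_l// max_r// [Phi t * _]mulrC.
have [t _|c /andP[ac cb]] := @mvt_segment _ F (fun t => (1 - Phi x) + t * F t) _ _ ab.
  have d1 : is_derive t 1 (fun z => (1 - Phi x) * Phi z) ((1 - Phi x) * gpdf t).
    apply: (is_derive_eq (is_deriveM (is_derive_cst (1 - Phi x) t 1) (is_derive_Phi t))).
    by rewrite /GRing.scale/= mulr0 addr0.
  apply: (is_derive_eq (is_derive_div_gpdf d1)).
  have g0 : gpdf t != 0 by rewrite gt_eqF ?gpdf_gt0.
  by rewrite /F; field.
rewrite -!FE ?(ltW ab) ?(le_trans cb)//; last by rewrite (le_trans _ bx)// ltW.
move=> ->.
have -> : (1 - Phi x + c * stein x c) * (b - a) - (1 - Phi x) * (b - a) =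
  c * stein x c * (b - a) by ring.
by rewrite !ler_pM2r ?subr_gt0// lohi// ac.
Qed.

Lemma stein_incr_right x a b lo hi : a <= b -> x <= a ->
  (forall t, a <= t <= b -> lo <= t * stein x t <= hi) ->
  lo * (b - a) <= stein x b - stein x a + Phi x * (b - a) <= hi * (b - a).
Proof.
rewrite le_eqVlt => /predU1P[<- _ _|ab xa lohi].
  by rewrite !subrr !mulr0 addr0 lexx.
pose F z := Phi x * (1 - Phi z) / gpdf z.
have FE t : x <= t -> stein x t = F t.
  by move=> tx; rewrite /stein /F min_r// max_l.
have [t _|c /andP[ac cb]] := @mvt_segment _ F (fun t => - Phi x + t * F t) _ _ ab.
  have d2 : is_derive t 1 (fun z => Phi x * (1 - Phi z)) (- (Phi x * gpdf t)).
    have d1 := is_deriveB (is_derive_cst (1 : R) t 1) (is_derive_Phi t).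
    apply: (is_derive_eq (is_deriveM (is_derive_cst (Phi x) t 1) d1)).
    by rewrite /GRing.scale/= mulr0 addr0 sub0r mulrN.
  apply: (is_derive_eq (is_derive_div_gpdf d2)).
  have g0 : gpdf t != 0 by rewrite gt_eqF ?gpdf_gt0.
  by rewrite /F; field.
rewrite -!FE ?(le_trans xa)// ?(ltW ab)//.
move=> ->.
have -> : (- Phi x + c * stein x c) * (b - a) + Phi x * (b - a) =
  c * stein x c * (b - a) by ring.
by rewrite !ler_pM2r ?subr_gt0// lohi// ac.
Qed.

(** Stein's equation integrated over [[a, b]]: the minima are the integral of the indicator, and
    [lo], [hi] enclose the integrand [t * stein x t]. The integrated form needs no derivative at
    [x], where the two smooth branches are glued. *)
Lemma stein_incr x a b lo hi : a <= b ->
  (forall t, a <= t <= b -> lo <= t * stein x t <= hi) ->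
  lo * (b - a) <=
    stein x b - stein x a - (Num.min b x - Num.min a x) + Phi x * (b - a)
  <= hi * (b - a).
Proof.
move=> ab lohi; have [bx|xb] := leP b x.
  have /andP[] := stein_incr_left ab bx lohi.
  by rewrite min_l ?(le_trans ab)// => ? ?; apply/andP; split; nra.
have [xa|ax] := leP x a.
  have /andP[] := stein_incr_right ab xa lohi.
  by move=> ? ?; apply/andP; split; nra.
have /andP[l1 h1] : lo * (x - a) <=
    stein x x - stein x a - (1 - Phi x) * (x - a) <= hi * (x - a).
  apply: stein_incr_left; rewrite ?(ltW ax)// => t /andP[at_ tx].
  by rewrite lohi// at_ (le_trans tx)// ltW.
have /andP[l2 h2] : lo * (b - x) <=
    stein x b - stein x x + Phi x * (b - x) <= hi * (b - x).
  apply: stein_incr_right; rewrite ?(ltW xb)// => t /andP[xt tb].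
  by rewrite lohi// tb (le_trans _ xt)// ltW.
by apply/andP; split; nra.
Qed.

Lemma min_incr x a b : a <= b -> 0 <= Num.min b x - Num.min a x <= b - a.
Proof.
by move=> ab; have [bx|xb] := leP b x; have [ax|xa] := leP a x;
  apply/andP; split; lra.
Qed.

Lemma stein_lip x u v : `|stein x v - stein x u| <= 2 * `|v - u|.
Proof.
wlog uv : u v / u <= v.
  move=> h; have [/h//|/ltW/h] := leP u v.
  by rewrite distrC [`|u - v|]distrC.
rewrite [`|v - u|]ger0_norm ?subr_ge0//.
have /andP[lo hi] : -1 * (v - u) <=
    stein x v - stein x u - (Num.min v x - Num.min u x) + Phi x * (v - u)
  <= 1 * (v - u).
  apply: stein_incr => // t _; rewrite -ler_norml normrM.
  by rewrite [`|stein _ _|]ger0_norm ?stein_ge0// stein_mul.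
have /andP[m0 m1] := min_incr x uv.
have := Phi_ge0 x; have := Phi_le1 x => P1 P0.
by rewrite ler_norml; apply/andP; split; nra.
Qed.

Lemma stein_mul_lip x w t :
  `|t * stein x t - w * stein x w| <= (2 * `|w| + stein_bound) * `|t - w|.
Proof.
have -> : t * stein x t - w * stein x w =
  w * (stein x t - stein x w) + (t - w) * stein x t by ring.
apply: (le_trans (ler_normD _ _)); rewrite [leRHS]mulrDl lerD// normrM.
  rewrite [2 * _]mulrC -mulrA ler_wpM2l//; exact: stein_lip.
by rewrite mulrC ler_wpM2r// ger0_norm ?stein_ge0// stein_le.
Qed.

(* [w * stein x w + (w <= x)%R%:R - Phi x] is the derivative of [stein x] at [w],
   by Stein's equation; the last term of the bound pays for its jump at [x]. *)
Lemma stein_taylor_le x u v w : u <= w -> w <= v ->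
  `|stein x v - stein x u - (v - u) * (w * stein x w + (w <= x)%R%:R - Phi x)| <=
  (v - u) * ((2 * `|w| + stein_bound) * (v - u) + (`|w - x| <= v - u)%R%:R).
Proof.
move=> uw wv; have uv := le_trans uw wv.
set e := (2 * `|w| + stein_bound) * (v - u).
have /andP[lo hi] : (w * stein x w - e) * (v - u) <=
    stein x v - stein x u - (Num.min v x - Num.min u x) + Phi x * (v - u)
  <= (w * stein x w + e) * (v - u).
  apply: stein_incr => // t /andP[ut tv].
  have := stein_mul_lip x w t; rewrite ler_norml => /andP[h1 h2].
  have : (2 * `|w| + stein_bound) * `|t - w| <= e.
    have q0 : 0 <= 2 * `|w| + stein_bound.
      by apply: addr_ge0; [exact: mulr_ge0|exact: stein_bound_ge0].
    apply: ler_wpM2l => //.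
    by rewrite ler_norml; apply/andP; split; lra.
  by move=> h3; apply/andP; split; lra.
(* If [x] is farther than [v - u] from [w], then [u] and [v] lie on the same side of [x] and the
   difference vanishes; otherwise the trivial bound [v - u] is used. *)
have : `|Num.min v x - Num.min u x - (v - u) * (w <= x)%R%:R| <=
    (v - u) * (`|w - x| <= v - u)%R%:R.
  have /andP[m0 m1] := min_incr x uv.
  have [wx|wx] := boolP (`|w - x| <= v - u).
    by rewrite mulr1 ler_norml; case: (w <= x); rewrite ?mulr1 ?mulr0 /=;
      apply/andP; split; lra.
  rewrite mulr0 normr_le0; move: wx; rewrite -ltNge => wx.
  have [lewx|ltxw] := leP w x.
    move: wx; rewrite ler0_norm ?subr_le0// => wx.
    by rewrite !min_l ?mulr1 ?subrr//; lra.
  move: wx; rewrite gtr0_norm ?subr_gt0// => wx.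
  by rewrite !min_r ?mulr0 ?subrr//; lra.
move=> mB; rewrite [leRHS]mulrDr.
have -> : stein x v - stein x u -
    (v - u) * (w * stein x w + (w <= x)%R%:R - Phi x) =
    (stein x v - stein x u - (Num.min v x - Num.min u x) + Phi x * (v - u) -
      w * stein x w * (v - u)) +
    (Num.min v x - Num.min u x - (v - u) * (w <= x)%R%:R) by ring.
apply: (le_trans (ler_normD _ _)); apply: lerD => //.
rewrite ler_norml lerBrDr lerBlDr.
by move: lo hi; rewrite mulrBl mulrDl [e * _]mulrC => lo hi; apply/andP; split; lra.
Qed.

(** The form needed for a flipped coordinate: the sign of its coefficient decides whether the linear
    form moves up or down, and the current value [w] is always one of the two ends. *)
Lemma stein_taylor x u v w : w = u \/ w = v ->
  `|stein x v - stein x u - (v - u) * (w * stein x w + (w <= x)%R%:R - Phi x)| <=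
  `|v - u| * ((2 * `|w| + stein_bound) * `|v - u| + (`|w - x| <= `|v - u|)%R%:R).
Proof.
wlog uv : u v / u <= v.
  move=> h wuv; have [uv|/ltW vu] := leP u v; first exact: h.
  have := h v u vu; rewrite -[`|u - v|]distrC => /(_ _) h'.
  rewrite -normrN; apply: le_trans (h' _); last by case: wuv; [right|left].
  by rewrite le_eqVlt; apply/orP; left; apply/eqP; congr (`| _ |); ring.
rewrite [`|v - u|]ger0_norm ?subr_ge0// => -[->|->]; exact: stein_taylor_le.
Qed.

End stein_solution.

(** * Weighted sums of independent Bernoulli variables *)

Section bernoulli_cube.
Context {R : realType} (p : R) (I : finType).
Hypothesis p01 : 0 < p < 1.
Implicit Types (x h M : R) (F G H : {ffun I -> bool} -> R) (v : I -> R) (k : I).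
Implicit Types b : {ffun I -> bool}.

Definition bern_sd : R := Num.sqrt (p * (1 - p)).
Definition bern_weight (c : bool) : R := if c then p else 1 - p.
Definition bern_std (c : bool) : R := (c%:R - p) / bern_sd.
Definition cube_weight b : R := \prod_k bern_weight (b k).
Definition Ex F : R := \sum_b cube_weight b * F b.
Definition setb b k (c : bool) : {ffun I -> bool} :=
  [ffun i => if i == k then c else b i].
(** A discrete derivative that always runs from false to true, so that its value does not depend on
    [b k]. *)
Definition diffb k F b : R := F (setb b k true) - F (setb b k false).
Definition lin v b : R := \sum_k v k * bern_std (b k).

Local Notation sd := bern_sd.

Lemma bern_sd_gt0 : 0 < sd.
Proof. by case/andP: p01 => p0 p1; rewrite sqrtr_gt0 mulr_gt0// subr_gt0. Qed.

Lemma bern_sd_sqr : sd ^+ 2 = p * (1 - p).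
Proof.
by case/andP: p01 => p0 p1; rewrite sqr_sqrtr// mulr_ge0 ?subr_ge0 ?ltW.
Qed.

Lemma cube_weight_ge0 b : 0 <= cube_weight b.
Proof.
case/andP: p01 => p0 p1; apply: prodr_ge0 => k _.
by rewrite /bern_weight; case: (b k); rewrite ?subr_ge0 ltW.
Qed.

Lemma ExD F G : Ex (fun b => F b + G b) = Ex F + Ex G.
Proof. by rewrite -big_split; apply: eq_bigr => b _; rewrite mulrDr. Qed.

Lemma ExZ c F : Ex (fun b => c * F b) = c * Ex F.
Proof. by rewrite mulr_sumr; apply: eq_bigr => b _; rewrite mulrCA. Qed.

Lemma ExB F G : Ex (fun b => F b - G b) = Ex F - Ex G.
Proof. by rewrite -sumrB; apply: eq_bigr => b _; rewrite mulrBr. Qed.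

Lemma eq_Ex F G : F =1 G -> Ex F = Ex G.
Proof. by move=> FG; apply: eq_bigr => b _; rewrite FG. Qed.

Lemma Ex_sum (J : Type) (r : seq J) (F : J -> {ffun I -> bool} -> R) :
  Ex (fun b => \sum_(j <- r) F j b) = \sum_(j <- r) Ex (F j).
Proof.
rewrite /Ex exchange_big; apply: eq_bigr => b _; exact: mulr_sumr.
Qed.

Lemma Ex_le F G : (forall b, F b <= G b) -> Ex F <= Ex G.
Proof.
by move=> FG; apply: ler_sum => b _; apply: ler_wpM2l => //; exact: cube_weight_ge0.
Qed.

Lemma Ex_cst c : Ex (fun=> c) = c.
Proof.
rewrite /Ex -mulr_suml /cube_weight -(bigA_distr_bigA (fun (_ : I) => bern_weight)).
rewrite big1 ?mul1r// => k _.
by rewrite big_bool /= addrC subrK.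
Qed.

Lemma Ex_norm F : `|Ex F| <= Ex (fun b => `|F b|).
Proof.
apply: le_trans (ler_norm_sum _ _ _) _; apply: ler_sum => b _.
by rewrite normrM ger0_norm// cube_weight_ge0.
Qed.

Lemma setb_eq b k : setb b k (b k) = b.
Proof. by apply/ffunP => i; rewrite ffunE; case: eqP => // ->. Qed.

Lemma setbK b k c c' : setb (setb b k c) k c' = setb b k c'.
Proof. by apply/ffunP => i; rewrite !ffunE; case: eqP. Qed.

Lemma setb_at b k c : setb b k c k = c.
Proof. by rewrite ffunE eqxx. Qed.

Lemma cube_weight_setb b k c :
  cube_weight (setb b k c) = bern_weight c * \prod_(i | i != k) bern_weight (b i).
Proof.
rewrite /cube_weight (bigD1 k)//= setb_at; congr (_ * _).
by apply: eq_bigr => i /negPf ik; rewrite ffunE ik.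
Qed.

(** The cube is split into pairs of configurations that differ only at [k], each pair being
    represented by its member with [b k] true. *)
Lemma Ex_condition k F : Ex F =
  \sum_(b : {ffun I -> bool} | b k) (\prod_(i | i != k) bern_weight (b i)) *
    (p * F (setb b k true) + (1 - p) * F (setb b k false)).
Proof.
rewrite /Ex (bigID (fun b => b k))/=.
rewrite [X in _ + X](reindex_onto (fun b => setb b k false)
  (fun b => setb b k true)) /=; last first.
  by move=> b /negPf bk; rewrite setbK -bk setb_eq.
rewrite [X in _ + X](eq_bigl (fun b => b k)); last first.
  move=> b; rewrite setb_at/= setbK; apply/eqP/idP => [<-|bk].
    by rewrite setb_at.
  by rewrite -bk setb_eq.
rewrite -big_split/=; apply: eq_bigr => b bk.
rewrite cube_weight_setb -{1 2}(setb_eq b k) cube_weight_setb bk /bern_weight.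
by ring.
Qed.

(** Discrete integration by parts: within a pair, probability times standardized value is
    [p * (1 - p) / sd = sd] for true and [- sd] for false. *)
Lemma Ex_diffb k F : Ex (fun b => bern_std (b k) * F b) = sd * Ex (diffb k F).
Proof.
have sd0 : sd != 0 by rewrite gt_eqF ?bern_sd_gt0.
rewrite (Ex_condition k) [Ex (diffb k F)](Ex_condition k) mulr_sumr.
apply: eq_bigr => b _; rewrite /diffb !setbK !setb_at /bern_std /=.
rewrite [RHS]mulrCA !(mulr0n, mulr1n); congr (_ * _).
have -> : sd * (p * (F (setb b k true) - F (setb b k false)) +
     (1 - p) * (F (setb b k true) - F (setb b k false))) =
  sd ^+ 2 * (F (setb b k true) - F (setb b k false)) / sd by field.
by rewrite bern_sd_sqr; field.
Qed.

Lemma lin_setb v b k c : lin v (setb b k c) =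
  v k * bern_std c + \sum_(i | i != k) v i * bern_std (b i).
Proof.
rewrite /lin (bigD1 k)//= setb_at; congr (_ + _).
by apply: eq_bigr => i /negPf ik; rewrite ffunE ik.
Qed.

Lemma diffb_lin v k b : diffb k (lin v) b = v k / sd.
Proof.
rewrite /diffb !lin_setb /bern_std /=.
have sd0 : sd != 0 by rewrite gt_eqF ?bern_sd_gt0.
by field.
Qed.

Lemma setb_or b k : b = setb b k false \/ b = setb b k true.
Proof. by rewrite -{1 3}(setb_eq b k); case: (b k); [right|left]. Qed.

Lemma Ex_lin v F :
  Ex (fun b => lin v b * F b) = \sum_k v k * sd * Ex (diffb k F).
Proof.
transitivity (Ex (fun b => \sum_k v k * (bern_std (b k) * F b))).
  by apply: eq_Ex => b; rewrite /lin mulr_suml; apply: eq_bigr => k _; rewrite mulrA.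
by rewrite Ex_sum; apply: eq_bigr => k _; rewrite ExZ Ex_diffb mulrA.
Qed.

Lemma Ex_lin_sqr v : Ex (fun b => lin v b ^+ 2) = \sum_k v k ^+ 2.
Proof.
rewrite (eq_Ex (G := fun b => lin v b * lin v b)) // Ex_lin.
apply: eq_bigr => k _.
rewrite (eq_Ex (diffb_lin v k)) Ex_cst.
have sd0 : sd != 0 by rewrite gt_eqF ?bern_sd_gt0.
by field.
Qed.

(** Obtained from the second moment through [|w| <= (1 + w ^ 2) / 2]. *)
Lemma Ex_norm_lin v : \sum_k v k ^+ 2 = 1 -> Ex (fun b => `|lin v b|) <= 1.
Proof.
move=> v1.
apply: (@le_trans _ _ (Ex (fun b => 2^-1 * 1 + 2^-1 * lin v b ^+ 2))).
  apply: Ex_le => b; rewrite -(real_normK (num_real (lin v b))).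
  by have : 0 <= (`|lin v b| - 1) ^+ 2 by [exact: sqr_ge0]; nra.
by rewrite ExD !ExZ Ex_cst Ex_lin_sqr v1; lra.
Qed.

Definition cubes v : R := \sum_k `|v k| ^+ 3.

Lemma cubes_ge0 v : 0 <= cubes v.
Proof. by apply: sumr_ge0 => k _; rewrite exprn_ge0. Qed.

Lemma cubes_gt0 v : \sum_k v k ^+ 2 = 1 -> 0 < cubes v.
Proof.
move=> v1; rewrite lt_neqAle cubes_ge0 andbT; apply/eqP => /esym/eqP.
rewrite psumr_eq0 => [/allP v0|k _]; last by rewrite exprn_ge0.
have : \sum_k v k ^+ 2 = 0.
  apply: big1 => k _; have := v0 k; rewrite mem_index_enum => /(_ isT).
  by rewrite /= expf_eq0 normr_eq0 /= => /eqP ->; rewrite expr0n.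
by rewrite v1 => /eqP; rewrite oner_eq0.
Qed.

Definition clamp (c y : R) := Num.max (- c) (Num.min c y).

(** The end [y] lies in [[-h, h]], so the clamp keeps slope 1 for a distance at least [d] from it in
    either direction. *)
Lemma clamp_incr (h d u w y : R) : 0 <= h -> 0 <= d -> u <= w ->
  y = u \/ y = w -> - h <= y <= h ->
  Num.min d (w - u) <= clamp (h + d) w - clamp (h + d) u.
Proof.
move=> h0 d0 uw yuw /andP[y1 y2]; rewrite /clamp.
have [a|a] := leP d (w - u); have [b|b] := leP (h + d) w;
  have [e|e] := leP (h + d) u; have [g|g] := leP (- (h + d)) w;
  have [i|i] := leP (- (h + d)) u; have [j|j] := leP (- (h + d)) (h + d);
  case: yuw => ?; lra.
Qed.

Lemma clamp_homo (c u w : R) : u <= w -> clamp c u <= clamp c w.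
Proof.
move=> uw; rewrite /clamp.
have [b|b] := leP c w; have [e|e] := leP c u; have [g|g] := leP (- c) w;
  have [i|i] := leP (- c) u; have [j|j] := leP (- c) c; lra.
Qed.

Lemma clamp_norm (c y : R) : 0 <= c -> `|clamp c y| <= c.
Proof.
move=> c0; rewrite /clamp ler_norml; have [a|a] := leP c y;
have [b|b] := leP (- c) y; have [d|d] := leP (- c) c; apply/andP; split; lra.
Qed.

(* Since [\sum_k v k ^+ 2 = 1], the identity [Ex_lin] applied to a clamp of slope 1
   on a neighbourhood of radius [d = cubes v / (2 * sd)] of the interval bounds half
   the probability of the interval by [E |W|] times the height [h + d] of the clamp;
   min d y >= y - y ^ 2 / (4 * d) makes the choice of [d] work. *)
Lemma concentration v x h : \sum_k v k ^+ 2 = 1 -> 0 <= h ->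
  Ex (fun b => (`|lin v b - x| <= h)%R%:R) <= 2 * h + cubes v / sd.
Proof.
move=> v1 h0; have g0 := cubes_gt0 v1; have s0 := bern_sd_gt0.
have sd0 : sd != 0 by rewrite gt_eqF.
pose d := cubes v / (2 * sd).
have d0 : 0 < d by rewrite divr_gt0 ?mulr_gt0.
pose f b := clamp (h + d) (lin v b - x).
pose A b : R := (`|lin v b - x| <= h)%R%:R.
have up : Ex (fun b => lin v b * f b) <= h + d.
  apply: (@le_trans _ _ (Ex (fun b => (h + d) * `|lin v b|))).
    apply: Ex_le => b; apply: le_trans (ler_norm _) _; rewrite normrM mulrC.
    by rewrite ler_wpM2r// clamp_norm// addr_ge0// ltW.
  by rewrite ExZ ler_piMr ?Ex_norm_lin// addr_ge0// ltW.
have lo k b : (v k ^+ 2 - `|v k| ^+ 3 / (4 * d * sd)) * A b <=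
    v k * sd * diffb k f b.
  have dk := diffb_lin v k b; rewrite /diffb in dk.
  rewrite /diffb /f; set w1 := lin v (setb b k true) in dk *.
  set w0 := lin v (setb b k false) in dk *.
  have yE : lin v b = w0 \/ lin v b = w1.
    by case: (setb_or b k) => E; [left|right]; rewrite {1}E.
  (* Stated for ordered ends, so that it serves both signs of [v k]: flipping [k] to true raises the
     linear form exactly when [v k] is positive. *)
  have key u w : u <= w -> lin v b = u \/ lin v b = w -> w - u = `|v k| / sd ->
      (v k ^+ 2 - `|v k| ^+ 3 / (4 * d * sd)) * A b <=
      `|v k| * sd * (clamp (h + d) (w - x) - clamp (h + d) (u - x)).
    move=> uw yuw wu; rewrite /A.
    have [yh|_] := boolP (`|lin v b - x| <= h); last first.
      rewrite mulr0 mulr_ge0 ?mulr_ge0 ?(ltW s0)// subr_ge0 clamp_homo//.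
      by rewrite lerD2r.
    rewrite mulr1.
    apply: (@le_trans _ _ (`|v k| * sd * Num.min d (`|v k| / sd))); last first.
      apply: ler_wpM2l; first by rewrite mulr_ge0 ?(ltW s0).
      rewrite -wu -[w - u](_ : w - x - (u - x) = _); last by ring.
      apply: (@clamp_incr _ _ _ _ (lin v b - x)); rewrite ?(ltW d0)//.
      - by rewrite lerD2r.
      - by case: yuw => ->; [left|right].
      - by rewrite -ler_norml.
    rewrite -(real_normK (num_real (v k))).
    have -> : `|v k| ^+ 2 - `|v k| ^+ 3 / (4 * d * sd) =
      `|v k| * sd * (`|v k| / sd - (`|v k| / sd) ^+ 2 / (4 * d)).
      by field; rewrite sd0 gt_eqF.
    apply: ler_wpM2l; first by rewrite mulr_ge0 ?(ltW s0).
    set y := `|v k| / sd.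
    have d4 : 0 < 4 * d by rewrite mulr_gt0.
    have y2 : 0 <= y ^+ 2 / (4 * d) by exact: divr_ge0 (sqr_ge0 _) (ltW d4).
    have : y - y ^+ 2 / (4 * d) <= d.
      rewrite -subr_ge0.
      have -> : d - (y - y ^+ 2 / (4 * d)) = (y - 2 * d) ^+ 2 / (4 * d).
        by field; rewrite gt_eqF.
      by exact: divr_ge0 (sqr_ge0 _) (ltW d4).
    by rewrite le_min => ->/=; lra.
  have [vk|vk] := leP 0 (v k).
    have := key w0 w1; rewrite ger0_norm// -dk; apply=> //.
    by rewrite -subr_ge0 dk divr_ge0 ?(ltW s0).
  have := key w1 w0; rewrite ltr0_norm// mulNr -dk opprB.
  have -> : - v k * sd * (clamp (h + d) (w0 - x) - clamp (h + d) (w1 - x)) =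
    v k * sd * (clamp (h + d) (w1 - x) - clamp (h + d) (w0 - x)) by ring.
  apply=> //; last by case: yE; [right|left].
  by rewrite -subr_le0 dk; apply: mulr_le0_ge0; rewrite ?invr_ge0 ltW.
(* Summed over [k], the coefficients give [1 - cubes v / (4 * d * sd)], which is one half by the
   choice of [d]. *)
have {lo} : 2^-1 * Ex A <= Ex (fun b => lin v b * f b).
  rewrite Ex_lin.
  have -> : 2^-1 * Ex A =
      \sum_k (v k ^+ 2 - `|v k| ^+ 3 / (4 * d * sd)) * Ex A.
    rewrite -mulr_suml; congr (_ * _); rewrite sumrB v1 -mulr_suml -/(cubes v).
    by rewrite /d; field; rewrite sd0 gt_eqF.
  by apply: ler_sum => k _; rewrite -!ExZ; apply: Ex_le => b; exact: lo.
move=> lo; have := le_trans lo up.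
have -> : cubes v / sd = 2 * d by rewrite /d; field.
by lra.
Qed.

(* With [G = 1] this is the Berry-Esseen bound; the sum involving [diffb k G] is
   small when [G] depends on linear forms orthogonal to [v]. *)
Lemma stein_error v x G M (lam : I -> R) : \sum_k v k ^+ 2 = 1 ->
  (forall b, `|G b| <= M) -> (forall k b, `|diffb k G b| <= lam k) ->
  `|Ex (fun b => ((lin v b <= x)%R%:R - Phi x) * G b +
       \sum_k v k * sd * stein x (lin v b) * diffb k G b)|
  <= M * (5 + @stein_bound R) * (cubes v / sd) + 2 * \sum_k v k ^+ 2 * lam k.
Proof.
move=> v1 GM Glam; have s0 := bern_sd_gt0.
have sd0 : sd != 0 by rewrite gt_eqF.
have M0 : 0 <= M by apply: le_trans (GM [ffun=> true]).
pose W := lin v; pose f b := stein x (lin v b).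
pose df b := W b * f b + (W b <= x)%R%:R - Phi x.
pose T k b := v k ^+ 2 * (df b * G b) -
  v k * sd * diffb k (fun b => f b * G b) b + v k * sd * f b * diffb k G b.
pose B k b := M * v k ^+ 2 *
  ((2 * `|W b| + stein_bound) * (`|v k| / sd) +
   (`|W b - x| <= `|v k| / sd)%R%:R) + 2 * v k ^+ 2 * lam k.
have -> : Ex (fun b => ((lin v b <= x)%R%:R - Phi x) * G b +
       \sum_k v k * sd * stein x (lin v b) * diffb k G b) =
    Ex (fun b => \sum_k T k b).
  transitivity (Ex (fun b => df b * G b) - Ex (fun b => W b * (f b * G b)) +
      Ex (fun b => \sum_k v k * sd * f b * diffb k G b)).
    rewrite -ExB -ExD; apply: eq_Ex => b; rewrite /df -/(W b); congr (_ + _).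
    by ring.
  rewrite Ex_lin Ex_sum (_ : Ex (fun b => \sum_k T k b) = \sum_k Ex (T k)); last first.
    exact: Ex_sum.
  rewrite -[Ex (fun b => df b * G b)]mul1r -v1 mulr_suml -sumrB -big_split/=.
  by apply: eq_bigr => k _; rewrite -!ExZ -ExB -ExD.
have TB k b : `|T k b| <= B k b.
  have dk := diffb_lin v k b; rewrite /diffb in dk.
  have bE := setb_or b k; have lamk := Glam k b.
  rewrite /T /B /diffb in lamk *.
  set b1 := setb b k true in bE dk lamk *.
  set b0 := setb b k false in bE dk lamk *.
  set a := v k in dk *.
  (* Product rule based at [b]. As [b] is [b0] or [b1], one of the last two products vanishes and
     the other is a product of an increment of [f] and one of [G]; these second-order terms give the
     sum with [lam]. *)
  have -> : a ^+ 2 * (df b * G b) - a * sd * (f b1 * G b1 - f b0 * G b0) +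
      a * sd * f b * (G b1 - G b0) =
    - (a * sd * (f b1 - f b0 - a / sd * df b) * G b) +
    a * sd * ((f b - f b1) * (G b1 - G b) + (f b - f b0) * (G b - G b0)).
    by field.
  apply: (le_trans (ler_normD _ _)); apply: lerD.
    rewrite normrN !normrM [`|sd|]gtr0_norm//.
    have := @stein_taylor _ x (W b0) (W b1) (W b) _.
    rewrite dk -/(f b1) -/(f b0) -/(f b) -/(df b) normrM normfV [`|sd|]gtr0_norm//.
    move=> tay; rewrite [M * _]mulrC -[a ^+ 2]real_normK ?num_real//.
    rewrite -!mulrA [M * _]mulrC !mulrA; apply: ler_pM => //; rewrite ?mulr_ge0 ?(ltW s0)//.
    apply: (@le_trans _ _ (`|a| * sd * (`|a| / sd *
      ((2 * `|W b| + stein_bound) * (`|a| / sd) + (`|W b - x| <= `|a| / sd)%R%:R)))).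
      apply: ler_wpM2l; first by rewrite mulr_ge0 ?(ltW s0).
      by apply: tay; case: bE => E; [left|right]; rewrite {1}E.
    by rewrite le_eqVlt; apply/orP; left; apply/eqP; field.
  have lip c : c \in [:: b0; b1] -> `|f b - f c| <= 2 * (`|a| / sd).
    move=> cb; apply: le_trans (stein_lip _ _ _) _; apply: ler_wpM2l => //.
    have -> : `|a| / sd = `|W b1 - W b0|.
      by rewrite dk normrM normfV [`|sd|]gtr0_norm.
    move: cb; rewrite !inE => /orP[] /eqP ->; case: bE => {1}->;
      by rewrite -/(W b1) -/(W b0) ?subrr ?normr0// distrC.
  rewrite normrM.
  have -> : 2 * a ^+ 2 * lam k = `|a * sd| * (2 * (`|a| / sd) * lam k).
    rewrite normrM [`|sd|]gtr0_norm// -[a ^+ 2]real_normK ?num_real//.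
    by field.
  apply: ler_wpM2l => //.
  case: bE => E.
    rewrite -E subrr mul0r addr0 normrM; apply: ler_pM => //; last by rewrite {1}E.
    by apply: lip; rewrite !inE eqxx orbT.
  rewrite -E subrr mul0r add0r normrM; apply: ler_pM => //; last by rewrite {1}E.
  by apply: lip; rewrite !inE eqxx.
apply: (le_trans (Ex_norm _)).
apply: (@le_trans _ _ (Ex (fun b => \sum_k B k b))).
  by apply: Ex_le => b; apply: le_trans (ler_norm_sum _ _ _) _; exact: ler_sum.
rewrite Ex_sum.
(* Origin of the 5: 2 comes from [2 * E|W|], and [concentration] at radius [|v k| / sd] contributes
   2 through its radius and 1 through its [cubes v / sd], as the squares sum to 1. *)
have -> : M * (5 + stein_bound) * (cubes v / sd) + 2 * (\sum_k v k ^+ 2 * lam k) =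
  \sum_k (M * v k ^+ 2 * ((2 + stein_bound) * (`|v k| / sd) +
    (2 * (`|v k| / sd) + cubes v / sd)) + 2 * v k ^+ 2 * lam k).
  rewrite big_split/= mulr_sumr; congr (_ + _); last first.
    by apply: eq_bigr => k _; rewrite mulrA.
  transitivity (M * (4 + stein_bound) / sd * cubes v +
    M * (cubes v / sd) * \sum_k v k ^+ 2); first by rewrite v1; field.
  rewrite {1}/cubes !mulr_sumr -big_split/=; apply: eq_bigr => k _.
  by rewrite -[v k ^+ 2]real_normK ?num_real//; field.
apply: ler_sum => k _; rewrite /B ExD Ex_cst lerD2r ExZ.
apply: ler_wpM2l; first by rewrite mulr_ge0// sqr_ge0.
have vs : 0 <= `|v k| / sd by rewrite divr_ge0 ?(ltW s0).
rewrite ExD; apply: lerD; last exact: concentration.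
rewrite (eq_Ex (G := fun b => (`|v k| / sd) * (2 * `|W b| + stein_bound))); last first.
  by move=> b; rewrite mulrC.
rewrite ExZ mulrC; apply: ler_wpM2r => //.
by rewrite ExD ExZ Ex_cst lerD2r; have := Ex_norm_lin v1; rewrite -/W; lra.
Qed.

Lemma berry_esseen_cube v x : \sum_k v k ^+ 2 = 1 ->
  `|Ex (fun b => (lin v b <= x)%R%:R) - Phi x| <=
  (5 + @stein_bound R) / sd * cubes v.
Proof.
move=> v1.
have := @stein_error v x (fun=> 1) 1 (fun=> 0) v1 _ _.
rewrite (_ : Ex _ = Ex (fun b => (lin v b <= x)%R%:R) - Phi x); last first.
  rewrite -[in RHS](Ex_cst (Phi x)) -ExB; apply: eq_Ex => b.
  by rewrite big1 ?addr0 ?mulr1// => k _; rewrite /diffb subrr mulr0.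
rewrite big1 => [|k _]; last by rewrite mulr0.
rewrite mulr0 addr0 mul1r => h; rewrite -mulrA [sd^-1 * _]mulrC; apply: h => //.
- by move=> b; rewrite normr1.
- by move=> k b; rewrite /diffb subrr normr0.
Qed.

End bernoulli_cube.

(** * The central limit theorem for products of test functions of orthonormal linear forms *)

Section product_clt.
Context {R : realType} (p : R).
Hypothesis p01 : 0 < p < 1.

Definition step_fun (r : seq (R * R)) (x : R) : R :=
  \sum_(q <- r) q.1 * (x <= q.2)%R%:R.

Definition step_mean (r : seq (R * R)) : R := \sum_(q <- r) q.1 * Phi q.2.

(* [c] is the mean of [g] under the standard normal law; it enters only through
   approximations of [g] by step functions. *)
Definition test_function (g : R -> R) (c : R) : Prop :=
  [/\ forall x, `|g x| <= 1, `|c| <= 1,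
      exists g' : R -> R, exists L : R,
        [/\ forall x, `|g' x| <= L,
            forall x y, `|g y - g x| <= L * `|y - x| &
            forall x y, `|g y - g x - (y - x) * g' x| <= L * (y - x) ^+ 2] &
      forall e : R, 0 < e -> exists r, (forall x, `|g x - step_fun r x| <= e) /\
        `|c - step_mean r| <= e].

Local Notation sd := (bern_sd p).

Section smooth.
Context (D I : finType) (v : D -> I -> R).
Implicit Types (K L eps : R) (G H : {ffun I -> bool} -> R).
Implicit Types (dG dH : D -> {ffun I -> bool} -> R).

(** Up to the factor [1 / sd], a common bound for the effect of flipping [k] on all the forms [v j];
    first-order and second-order errors are measured in [V k] and its square. *)
Let V k := \sum_j `|v j k|.

(* [dG j] plays the role of the partial derivative of [G] in the direction of the
   linear form [lin p (v j)]. *)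
Definition smooth (K : R) G dG : Prop :=
  [/\ forall b, `|G b| <= 1, forall j b, `|dG j b| <= K,
      forall k b, `|diffb k G b| <= K * V k &
      forall k b, `|diffb k G b - \sum_j v j k / sd * dG j b| <= K * V k ^+ 2].

Let V_ge0 k : 0 <= V k. Proof. exact: sumr_ge0. Qed.

Let le_V j k : `|v j k| <= V k.
Proof. by rewrite /V (bigD1 j)//= lerDl sumr_ge0. Qed.

Lemma smooth_cst1 : smooth 0 (fun=> 1) (fun _ _ => 0).
Proof.
split=> [b|j b|k b|k b]; rewrite ?normr1 ?normr0// ?mul0r /diffb subrr ?normr0//.
by rewrite big1 ?subrr ?normr0// => j _; rewrite mulr0.
Qed.

(** Leibniz rule; the extra [K1 * K2] pays for its discrete defect, which is plus or minus the
    product of the increments of [G] and [H]. *)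
Lemma smoothM K1 K2 G dG H dH : 0 <= K1 -> 0 <= K2 ->
  smooth K1 G dG -> smooth K2 H dH ->
  smooth (K1 + K2 + K1 * K2) (fun b => G b * H b)
    (fun j b => G b * dH j b + H b * dG j b).
Proof.
move=> K10 K20 [G1 dG1 DG TG] [H1 dH1 DH TH].
have K12 : 0 <= K1 * K2 by exact: mulr_ge0.
split=> [b|j b|k b|k b].
- by rewrite normrM -[leRHS]mulr1 ler_pM.
- apply: le_trans (ler_normD _ _) _; rewrite !normrM.
  have := ler_pM (normr_ge0 _) (normr_ge0 _) (G1 b) (dH1 j b).
  have := ler_pM (normr_ge0 _) (normr_ge0 _) (H1 b) (dG1 j b).
  by rewrite !mul1r; lra.
- have := DG k b; have := DH k b; rewrite /diffb.
  set b1 := setb b k true; set b0 := setb b k false => h g.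
  have -> : G b1 * H b1 - G b0 * H b0 =
    H b1 * (G b1 - G b0) + G b0 * (H b1 - H b0) by ring.
  apply: le_trans (ler_normD _ _) _; rewrite !normrM.
  have := ler_pM (normr_ge0 _) (normr_ge0 _) (G1 b0) h.
  have := ler_pM (normr_ge0 _) (normr_ge0 _) (H1 b1) g.
  have := mulr_ge0 K12 (V_ge0 k).
  by rewrite !mul1r !mulrDl; lra.
- have h := TH k b; have g := TG k b.
  have : `|diffb k G b * diffb k H b| <= K1 * K2 * V k ^+ 2.
    have -> : K1 * K2 * V k ^+ 2 = K1 * V k * (K2 * V k) by ring.
    by rewrite normrM ler_pM.
  have -> : diffb k (fun b => G b * H b) b -
      \sum_j v j k / sd * (G b * dH j b + H b * dG j b) =
    G b * (diffb k H b - \sum_j v j k / sd * dH j b) +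
    H b * (diffb k G b - \sum_j v j k / sd * dG j b) +
    (diffb k (fun b => G b * H b) b - G b * diffb k H b - H b * diffb k G b).
    rewrite (eq_bigr (fun j => G b * (v j k / sd * dH j b) +
      H b * (v j k / sd * dG j b))); last by move=> j _; ring.
    by rewrite big_split/= -!mulr_sumr; ring.
  move=> gh; apply: le_trans (ler_normD _ _) _.
  rewrite mulrDl; apply: lerD.
    apply: le_trans (ler_normD _ _) _; rewrite !normrM.
    have := ler_pM (normr_ge0 _) (normr_ge0 _) (G1 b) h.
    have := ler_pM (normr_ge0 _) (normr_ge0 _) (H1 b) g.
    by rewrite !mul1r mulrDl; lra.
  apply: le_trans gh; rewrite le_eqVlt; apply/orP; left; apply/eqP.
  rewrite /diffb; have := setb_or b k.
  set b1 := setb b k true; set b0 := setb b k false => -[->|->];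
    [|rewrite -normrN]; congr (`| _ |); ring.
Qed.

(** The three summands of the constant serve the bounds on the derivative, on the increment
    [v j0 k / sd], and on its square, respectively. *)
Lemma smooth_coord j0 (g g' : R -> R) L :
  (forall x, `|g x| <= 1) -> (forall x, `|g' x| <= L) ->
  (forall x y, `|g y - g x| <= L * `|y - x|) ->
  (forall x y, `|g y - g x - (y - x) * g' x| <= L * (y - x) ^+ 2) ->
  smooth (L + L / sd + L / sd ^+ 2) (fun b => g (lin p (v j0) b))
    (fun j b => if j == j0 then g' (lin p (v j0) b) else 0).
Proof.
move=> g1 g'L gL gT; have s0 := bern_sd_gt0 p01.
have L0 : 0 <= L by apply: le_trans (g'L 0).
have K10 : 0 <= L / sd by rewrite divr_ge0 ?(ltW s0).
have K20 : 0 <= L / sd ^+ 2 by rewrite divr_ge0 ?sqr_ge0.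
have vV k : `|v j0 k| / sd <= V k / sd by rewrite ler_pM2r ?invr_gt0.
split=> // [j b|k b|k b].
- by case: eqP => _; rewrite ?normr0 ?addr_ge0//; have := g'L (lin p (v j0) b); lra.
- have dk := diffb_lin p01 (v j0) k b; rewrite /diffb in dk *.
  apply: le_trans (gL _ _) _; rewrite dk normrM normfV [`|sd|]gtr0_norm//.
  have := ler_wpM2l L0 (vV k).
  by rewrite mulrCA [V k * _]mulrC; have := mulr_ge0 L0 (V_ge0 k);
    have := mulr_ge0 K20 (V_ge0 k); rewrite !mulrDl; lra.
- rewrite (_ : \sum_j _ = v j0 k / sd * g' (lin p (v j0) b)); last first.
    by rewrite (bigD1 j0)//= eqxx big1 ?addr0// => j /negPf ->; rewrite mulr0.
  have dk := diffb_lin p01 (v j0) k b; rewrite /diffb in dk *.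
  apply: (@le_trans _ _ (L * (v j0 k / sd) ^+ 2)).
    have := gT (lin p (v j0) (setb b k false)) (lin p (v j0) (setb b k true)).
    have := gT (lin p (v j0) (setb b k true)) (lin p (v j0) (setb b k false)).
    rewrite -[lin p (v j0) (setb b k false) - _]opprB dk sqrrN => h1 h0.
    case: (setb_or b k) => E; first by rewrite [in g' _]E.
    rewrite [in g' _]E -normrN; apply: le_trans h1.
    by rewrite le_eqVlt; apply/orP; left; apply/eqP; congr (`| _ |); ring.
  have : L * (v j0 k / sd) ^+ 2 <= L / sd ^+ 2 * V k ^+ 2.
    rewrite -mulrA; apply: ler_wpM2l => //.
    rewrite -[_ ^+ 2]real_normK ?num_real// -[_^-1 * _]mulrC -expr_div_n.
    rewrite lerXn2r ?nnegrE ?divr_ge0 ?(ltW s0)//.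
    by rewrite normrM normfV [`|sd|]gtr0_norm.
  have := sqr_ge0 (V k); set q := V k ^+ 2 => q0.
  by have := mulr_ge0 L0 q0; have := mulr_ge0 K10 q0; rewrite !mulrDl; lra.
Qed.

Hypothesis orth : forall i j, \sum_k v i k * v j k = (i == j)%:R.

Let v_sqr j : \sum_k v j k ^+ 2 = 1.
Proof. by have := orth j j; rewrite eqxx mulr1n => <-; apply: eq_bigr. Qed.

Let sum_normM i j : \sum_k `|v i k| * `|v j k| <= 1.
Proof.
apply: (@le_trans _ _ (\sum_k (2^-1 * v i k ^+ 2 + 2^-1 * v j k ^+ 2))).
  apply: ler_sum => k _; rewrite -[v i k ^+ 2]real_normK ?num_real//.
  rewrite -[v j k ^+ 2]real_normK ?num_real//.
  by have := sqr_ge0 (`|v i k| - `|v j k|); nra.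
by rewrite big_split/= -!mulr_sumr !v_sqr; lra.
Qed.

Let N : R := #|D|%:R.

Let sum_V_sqr : \sum_k V k ^+ 2 <= N ^+ 2.
Proof.
have -> : \sum_k V k ^+ 2 = \sum_i \sum_j \sum_k `|v i k| * `|v j k|.
  rewrite [RHS](eq_bigr (fun i => \sum_k \sum_j `|v i k| * `|v j k|)); last first.
    by move=> i _; exact: exchange_big.
  rewrite exchange_big; apply: eq_bigr => k _.
  rewrite expr2 {1}/V mulr_suml; apply: eq_bigr => i _; exact: mulr_sumr.
apply: (@le_trans _ _ (\sum_(i : D) \sum_(j : D) 1)).
  by do 2!(apply: ler_sum => ? _).
by rewrite sumr_const -[X in _ *+ X](_ : #|D| = _) // sumr_const -mulrnA expr2 /N -natrM.
Qed.

(** In the sum that [stein_error] carries along, the first-order part of [diffb k G] pairs [v j0]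
    with each [v j]: orthogonality kills [j != j0], and [dG j0 = 0] kills [j = j0]. The remainder is
    of order [V k ^ 2], weighted by [|v j0 k| <= eps]. *)
Lemma smooth_indicator K G dG j0 eps x : 0 <= K -> smooth K G dG ->
  (forall b, dG j0 b = 0) -> (forall j k, `|v j k| <= eps) ->
  `|Ex p (fun b => ((lin p (v j0) b <= x)%R%:R - Phi x) * G b)| <=
  ((5 + @stein_bound R) / sd + 2 * K * N + stein_bound * sd * K * N ^+ 2) * eps.
Proof.
move=> K0 [G1 _ DG TG] dG0 veps.
have s0 := bern_sd_gt0 p01; have c0 := @stein_bound_ge0 R.
have sd0 : sd != 0 by rewrite gt_eqF.
(* A negative [eps] would force [v j0 = 0], against its unit norm. *)
have [eps0|eps0] := leP 0 eps; last first.
  have v0 k : v j0 k = 0.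
    by apply/eqP; rewrite -normr_le0; apply: le_trans (ltW eps0).
  have := v_sqr j0; rewrite big1 => [/eqP|k _]; last by rewrite v0 expr0n.
  by rewrite eq_sym oner_eq0.
pose A b := ((lin p (v j0) b <= x)%R%:R - Phi x) * G b.
pose S b := \sum_k v j0 k * sd * stein x (lin p (v j0) b) * diffb k G b.
have cub : cubes (v j0) <= eps.
  rewrite /cubes -[leRHS]mulr1 -[in leRHS](v_sqr j0) mulr_sumr; apply: ler_sum => k _.
  by rewrite exprS real_normK ?num_real// ler_wpM2r ?sqr_ge0.
have SV : `|Ex p S| <= stein_bound * sd * K * N ^+ 2 * eps.
  apply: le_trans (Ex_norm p01 _) _.
  rewrite -[leRHS](Ex_cst p I); apply: Ex_le => // b.
  have -> : S b = stein x (lin p (v j0) b) * sd *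
      \sum_k v j0 k * (diffb k G b - \sum_j v j k / sd * dG j b).
    have -> : \sum_k v j0 k * (diffb k G b - \sum_j v j k / sd * dG j b) =
        \sum_k v j0 k * diffb k G b.
      rewrite -[RHS]subr0; under eq_bigr do rewrite mulrBr.
      rewrite sumrB; congr (_ - _).
      under eq_bigr do rewrite mulr_sumr.
      rewrite exchange_big big1// => j _.
      rewrite (eq_bigr (fun k => dG j b / sd * (v j0 k * v j k))); last first.
        by move=> k _; ring.
      rewrite -mulr_sumr orth.
      by have [<-|_] := eqVneq; rewrite ?dG0 ?mul0r ?mulr0.
    by rewrite mulr_sumr; apply: eq_bigr => k _; ring.
  have -> : stein_bound * sd * K * N ^+ 2 * eps =
    stein_bound * sd * (eps * K * N ^+ 2) by ring.
  have sW : 0 <= stein x (lin p (v j0) b) * sd by rewrite mulr_ge0 ?stein_ge0 ?ltW.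
  rewrite normrM (ger0_norm sW).
  apply: ler_pM => //.
    by apply: ler_wpM2r; rewrite ?(ltW s0)//; exact: stein_le.
  apply: le_trans (ler_norm_sum _ _ _) _.
  apply: (@le_trans _ _ (\sum_k eps * K * V k ^+ 2)).
    by apply: ler_sum => k _; rewrite normrM -mulrA ler_pM.
  by rewrite -mulr_sumr ler_wpM2l ?mulr_ge0.
have AS : `|Ex p (fun b => A b + S b)| <=
    ((5 + stein_bound) / sd + 2 * K * N) * eps.
  have := @stein_error _ p I p01 (v j0) x G 1 (fun k => K * V k) (v_sqr _) G1 DG.
  move=> h; apply: le_trans h _; rewrite mul1r [leRHS]mulrDl; apply: lerD.
    rewrite -mulrA [sd^-1 * _]mulrC; apply: ler_wpM2l; first exact: addr_ge0.
    by rewrite ler_pM2r ?invr_gt0.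
  rewrite -!mulrA; apply: ler_wpM2l => //.
  apply: (@le_trans _ _ (\sum_k K * eps * \sum_j `|v j0 k| * `|v j k|)).
    apply: ler_sum => k _; rewrite -mulr_sumr -/(V k).
    rewrite -real_normK ?num_real// mulrCA -mulrA ler_wpM2l//.
    by rewrite expr2 -mulrA ler_wpM2r// mulr_ge0.
  rewrite -mulr_sumr exchange_big/= -mulrA ler_wpM2l// mulrC ler_wpM2r//.
  apply: (@le_trans _ _ (\sum_(j : D) 1)); first exact: ler_sum.
  by rewrite sumr_const.
have -> : Ex p A = Ex p (fun b => A b + S b) - Ex p S by rewrite ExD addrK.
by apply: le_trans (ler_normB _ _) _; rewrite [leRHS]mulrDl lerD.
Qed.

End smooth.

(** [K] is chosen before [I] and [v], which makes the limit uniform in the dimension. The vanishing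
    of [dG] outside [s] is what [smooth_indicator] requires of the next coordinate. *)
Lemma prod_smooth (D : finType) (g : D -> R -> R) (c : D -> R) (s : seq D) :
  (forall j, test_function (g j) (c j)) ->
  exists2 K : R, 0 <= K & forall (I : finType) (v : D -> I -> R), exists2 dG,
    smooth v K (fun b => \prod_(j <- s) g j (lin p (v j) b)) dG &
    forall j b, j \notin s -> dG j b = 0.
Proof.
move=> gc; elim: s => [|j s [K K0 IH]].
  exists 0 => // I v; exists (fun _ _ => 0) => //.
  have := smooth_cst1 v; congr (smooth _ _ _ _).
  by apply/funext => b; rewrite big_nil.
have [g1 _ [g' [L [g'L gL gT]]] _] := gc j.
have L0 : 0 <= L by apply: le_trans (g'L 0).
have s0 := bern_sd_gt0 p01.
have H0 : 0 <= L + L / sd + L / sd ^+ 2 by rewrite !addr_ge0 ?divr_ge0 ?sqr_ge0 ?(ltW s0).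
exists (L + L / sd + L / sd ^+ 2 + K + (L + L / sd + L / sd ^+ 2) * K).
  by apply: addr_ge0; [exact: addr_ge0|exact: mulr_ge0].
move=> I v; have [dG sG dG0] := IH I v.
have sj := smooth_coord v j g1 g'L gL gT.
eexists; first have := smoothM H0 K0 sj sG.
  congr (smooth _ _ _ _).
  by apply/funext => b; rewrite big_cons.
move=> i b /=; rewrite inE negb_or => /andP[/negPf -> si].
by rewrite dG0// !mulr0 addr0.
Qed.

Definition orthonormal_family (D I : finType) (v : D -> I -> R) : Prop :=
  forall i j, \sum_k v i k * v j k = (i == j)%:R.

(* The coordinates are replaced by Gaussian ones one at a time: the step functions
   approximating [g j] reduce the replacement of coordinate [j] to [smooth_indicator],
   where the other factors enter as a smooth weight. *)
Lemma product_clt (D : finType) (g : D -> R -> R) (c : D -> R) (s : seq D) :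
  uniq s -> (forall j, test_function (g j) (c j)) ->
  forall e : R, 0 < e -> exists2 eps : R, 0 < eps &
  forall (I : finType) (v : D -> I -> R), orthonormal_family v ->
    (forall j k, `|v j k| <= eps) ->
    `|Ex p (fun b => \prod_(j <- s) g j (lin p (v j) b)) -
      \prod_(j <- s) c j| <= e.
Proof.
move=> us gc; elim: s us => [_|j s IH /= /andP[js us]] e e0.
  exists 1 => // I v _ _; rewrite big_nil.
  rewrite (_ : (fun b => _) = fun=> 1) ?Ex_cst ?subrr ?normr0 ?ltW//.
  by apply/funext => b; rewrite big_nil.
have [eps1 eps10 IH1] := IH us _ (divr_gt0 e0 (ltr0n _ 2)).
have [g1 c1 _ gr] := gc j.
(* Budget: [e / 2] for the induction hypothesis, [e / 4] for the step function, and [e / 8] each for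
   approximating [g j] and its mean [c j]. *)
have [r [gr1 cr]] := gr _ (divr_gt0 e0 (ltr0n _ 8)).
have [K K0 sm] := prod_smooth s gc.
pose N : R := #|D|%:R.
pose C := (5 + @stein_bound R) / sd + 2 * K * N + stein_bound * sd * K * N ^+ 2.
have s0 := bern_sd_gt0 p01; have cb0 := @stein_bound_ge0 R.
have C0 : 0 <= C.
  have N0 : 0 <= N by exact: ler0n.
  apply: addr_ge0; [apply: addr_ge0|].
  - by apply: divr_ge0; [exact: addr_ge0|exact: ltW].
  - by rewrite !mulr_ge0.
  - by rewrite !mulr_ge0 ?sqr_ge0 ?(ltW s0).
pose A := \sum_(q <- r) `|q.1|.
have A0 : 0 <= A by exact: sumr_ge0.
have AC0 : 0 < 4 * (A * C + 1) by rewrite mulr_gt0 ?ltr_wpDl ?mulr_ge0.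
(* Chosen so that [A * C * eps2 <= e / 4]; the [+ 1] covers the case [A * C = 0]. *)
pose eps2 := e / (4 * (A * C + 1)).
have eps20 : 0 < eps2 by rewrite divr_gt0.
exists (Num.min eps1 eps2); first by rewrite lt_min eps10.
move=> I v ov veps.
have veps1 i k : `|v i k| <= eps1 by apply: le_trans (veps i k) _; rewrite ge_min lexx.
have veps2 i k : `|v i k| <= eps2.
  by apply: le_trans (veps i k) _; rewrite ge_min lexx orbT.
have [dG sG dG0] := sm I v; have {}IH := IH1 I v ov veps1.
set G := (fun b => _) in sG IH; set PC := \prod_(j <- s) _ in IH.
have [G1 _ _ _] := sG.
pose X b := lin p (v j) b.
have step_le : `|Ex p (fun b => (step_fun r (X b) - step_mean r) * G b)| <= e / 4.
  have -> : Ex p (fun b => (step_fun r (X b) - step_mean r) * G b) =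
    \sum_(q <- r) q.1 * Ex p (fun b => ((X b <= q.2)%R%:R - Phi q.2) * G b).
    under eq_bigr do rewrite -ExZ.
    rewrite -Ex_sum; apply: eq_Ex => b.
    rewrite /step_fun /step_mean -sumrB mulr_suml; apply: eq_bigr => q _; ring.
  apply: le_trans (ler_norm_sum _ _ _) _.
  apply: (@le_trans _ _ (\sum_(q <- r) `|q.1| * (C * eps2))).
    apply: ler_sum => q _; rewrite normrM; apply: ler_wpM2l => //.
    by apply: (@smooth_indicator _ _ v ov K G dG) => // b; exact: dG0.
  rewrite -mulr_suml -/A mulrA /eps2 mulrA ler_pdivrMr//.
  by have := mulr_ge0 A0 C0; nra.
have gc_le : `|Ex p (fun b => (g j (X b) - c j) * G b)| <= e / 2.
  have -> : Ex p (fun b => (g j (X b) - c j) * G b) =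
    Ex p (fun b => (step_fun r (X b) - step_mean r) * G b) +
    Ex p (fun b => ((g j (X b) - step_fun r (X b)) - (c j - step_mean r)) * G b).
    by rewrite -ExD; apply: eq_Ex => b; ring.
  apply: le_trans (ler_normD _ _) _.
  have -> : e / 2 = e / 4 + e / 4 by field.
  apply: lerD => //; apply: le_trans (Ex_norm p01 _) _.
  rewrite -[leRHS](Ex_cst p I); apply: Ex_le => // b.
  rewrite normrM -[leRHS]mulr1; apply: ler_pM => //.
  apply: le_trans (ler_normB _ _) _.
  have -> : e / 4 = e / 8 + e / 8 by field.
  by rewrite lerD.
rewrite big_cons -/PC.
have -> : Ex p (fun b => \prod_(i <- j :: s) g i (lin p (v i) b)) - c j * PC =
    Ex p (fun b => (g j (X b) - c j) * G b) + c j * (Ex p G - PC).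
  rewrite mulrBr -ExZ addrA -ExD; congr (_ - _).
  by apply: eq_Ex => b; rewrite big_cons /G /X; ring.
apply: le_trans (ler_normD _ _) _.
have -> : e = e / 2 + e / 2 by field.
apply: lerD => //; rewrite normrM -[leRHS]mul1r; exact: ler_pM.
Qed.

End product_clt.

(** * Expectations of bounded random variables and spline test functions *)

Section bounded_expectation.
Context {R : realType} d (T : measurableType d) (P : probability T R).
Implicit Types (f g : T -> R) (a M : R).

(** This class is closed under all operations used below and consists of integrable functions, so
    integrability need not be tracked separately. *)
Definition bounded_measurable f : Prop :=
  measurable_fun [set: T] f /\ exists M, forall t, `|f t| <= M.

Definition mean f : R := Rintegral P [set: T] f.

Lemma bounded_measurable_integrable f : bounded_measurable f ->
  P.-integrable [set: T] (EFin \o f).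
Proof.
move=> [mf [M fM]]; apply: measurable_bounded_integrable => //.
  by rewrite (le_lt_trans (probability_le1 _ _)) ?ltry.
exists M; split=> [|N MN t _ /=]; first exact: num_real.
exact: le_trans (fM t) (ltW MN).
Qed.

Lemma expectationE f : bounded_measurable f -> 'E_P[f]%E = (mean f)%:E.
Proof.
move=> bf; rewrite unlock /mean /Rintegral fineK//.
by apply: integrable_fin_num => //; exact: bounded_measurable_integrable.
Qed.

Lemma bounded_measurable_cst a : bounded_measurable (fun=> a).
Proof. by split; [exact: measurable_cst|exists `|a|]. Qed.

Lemma bounded_measurableD f g : bounded_measurable f -> bounded_measurable g ->
  bounded_measurable (fun t => f t + g t).
Proof.
move=> [mf [M fM]] [mg [N gN]]; split; first exact: measurable_funD.
by exists (M + N) => t; apply: le_trans (ler_normD _ _) _; exact: lerD.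
Qed.

Lemma bounded_measurableM f g : bounded_measurable f -> bounded_measurable g ->
  bounded_measurable (fun t => f t * g t).
Proof.
move=> [mf [M fM]] [mg [N gN]]; split; first exact: measurable_funM.
by exists (M * N) => t; rewrite normrM; exact: ler_pM.
Qed.

Lemma bounded_measurableZ a f : bounded_measurable f ->
  bounded_measurable (fun t => a * f t).
Proof. exact/bounded_measurableM/bounded_measurable_cst. Qed.

Lemma bounded_measurableB f g : bounded_measurable f -> bounded_measurable g ->
  bounded_measurable (fun t => f t - g t).
Proof.
move=> bf /(bounded_measurableZ (-1)) /(bounded_measurableD bf).
by congr bounded_measurable; apply/funext => t; rewrite mulN1r.
Qed.

Lemma bounded_measurable_sum (J : Type) (r : seq J) (f : J -> T -> R) :
  (forall j, bounded_measurable (f j)) ->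
  bounded_measurable (fun t => \sum_(j <- r) f j t).
Proof.
move=> bf; elim: r => [|j r IH].
  have := bounded_measurable_cst 0; congr bounded_measurable.
  by apply/funext => t; rewrite big_nil.
have := bounded_measurableD (bf j) IH; congr bounded_measurable.
by apply/funext => t; rewrite big_cons.
Qed.

Lemma bounded_measurable_prod (J : Type) (r : seq J) (f : J -> T -> R) :
  (forall j, bounded_measurable (f j)) ->
  bounded_measurable (fun t => \prod_(j <- r) f j t).
Proof.
move=> bf; elim: r => [|j r IH].
  have := bounded_measurable_cst 1; congr bounded_measurable.
  by apply/funext => t; rewrite big_nil.
have := bounded_measurableM (bf j) IH; congr bounded_measurable.
by apply/funext => t; rewrite big_cons.
Qed.

Lemma bounded_measurable_indic (A : set T) : measurable A ->
  bounded_measurable (\1_A).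
Proof.
move=> mA; split; first exact: measurable_indic.
by exists 1 => t; rewrite indicE; case: (_ \in _); rewrite ?normr1 ?normr0.
Qed.

Lemma meanD f g : bounded_measurable f -> bounded_measurable g ->
  mean (fun t => f t + g t) = mean f + mean g.
Proof.
by move=> bf bg; rewrite /mean RintegralD//; exact: bounded_measurable_integrable.
Qed.

Lemma meanB f g : bounded_measurable f -> bounded_measurable g ->
  mean (fun t => f t - g t) = mean f - mean g.
Proof.
by move=> bf bg; rewrite /mean RintegralB//; exact: bounded_measurable_integrable.
Qed.

Lemma meanZ a f : bounded_measurable f -> mean (fun t => a * f t) = a * mean f.
Proof.
by move=> bf; rewrite /mean RintegralZl//; exact: bounded_measurable_integrable.
Qed.

Lemma mean_cst a : mean (fun=> a) = a.
Proof. by rewrite /mean Rintegral_cst// [X in _ * fine X](probability_setT P) mulr1. Qed.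

Lemma eq_mean f g : f =1 g -> mean f = mean g.
Proof. by move=> /funext ->. Qed.

Lemma mean_sum (J : Type) (r : seq J) (f : J -> T -> R) :
  (forall j, bounded_measurable (f j)) ->
  mean (fun t => \sum_(j <- r) f j t) = \sum_(j <- r) mean (f j).
Proof.
move=> bf; elim: r => [|j r IH].
  by rewrite big_nil -[RHS]mean_cst; apply: eq_mean => t; rewrite big_nil.
rewrite big_cons -IH -meanD//; last exact: bounded_measurable_sum.
by apply: eq_mean => t; rewrite big_cons.
Qed.

Lemma mean_le f g : bounded_measurable f -> bounded_measurable g ->
  (forall t, f t <= g t) -> mean f <= mean g.
Proof.
move=> bf bg fg; apply: le_Rintegral => //; exact: bounded_measurable_integrable.
Qed.

Lemma mean_dist f g h : bounded_measurable f -> bounded_measurable g ->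
  bounded_measurable h -> (forall t, `|f t - g t| <= h t) ->
  `|mean f - mean g| <= mean h.
Proof.
move=> bf bg bh fgh; rewrite -meanB// ler_norml; apply/andP; split.
  rewrite -mulN1r -meanZ//; apply: mean_le.
  - exact: bounded_measurableZ.
  - exact: bounded_measurableB.
  - by move=> t; have := fgh t; rewrite ler_norml mulN1r => /andP[].
apply: mean_le => //; first exact: bounded_measurableB.
by move=> t; have := fgh t; rewrite ler_norml => /andP[].
Qed.

Lemma mean_indic (A : set T) : measurable A -> (mean (\1_A))%:E = P A.
Proof.
move=> mA; rewrite -expectationE; last exact: bounded_measurable_indic.
by rewrite unlock integral_indic// setIT.
Qed.

Lemma bounded_measurable_comp (X : T -> R) (h : R -> R) M :
  measurable_fun [set: T] X -> measurable_fun [set: R] h ->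
  (forall x, `|h x| <= M) -> bounded_measurable (fun t => h (X t)).
Proof.
move=> mX mh hM; split; first exact: (measurableT_comp mh mX).
by exists M => t; exact: hM.
Qed.

End bounded_expectation.

(** * The quadratic B-spline: Taylor bound and partition of unity *)

Section bspline.
Context {R : realType}.
Implicit Types (t x y : R).

Definition ramp t : R := Num.max t 0.
Definition parab t : R := ramp t ^+ 2 / 2.
(** The integral of the hat function on [[0, 2]]: a continuously differentiable step from 0 to 1.
    Its translates make the B-spline sums telescope. *)
Definition smooth_step t : R := parab t - 2 * parab (t - 1) + parab (t - 2).
(* The quadratic B-spline, supported on [0, 3]. *)
Definition bspline t : R := smooth_step t - smooth_step (t - 1).

Lemma smooth_step_left t : t <= 0 -> smooth_step t = 0.
Proof. by rewrite /smooth_step /parab /ramp => t0; rewrite !max_r; lra. Qed.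

Lemma smooth_step_right t : 2 <= t -> smooth_step t = 1.
Proof. by rewrite /smooth_step /parab /ramp => t0; rewrite !max_l; lra. Qed.

Lemma smooth_step01 t : 0 <= smooth_step t <= 1.
Proof.
have [t0|t0] := leP t 0; first by rewrite smooth_step_left// lexx ler01.
have [t2|t2] := leP 2 t; first by rewrite smooth_step_right// lexx ler01.
rewrite /smooth_step /parab /ramp (@max_l _ _ t 0) ?(ltW t0)// (@max_r _ _ (t - 2)); last by lra.
by have [t1|t1] := leP (t - 1) 0; apply/andP; split; nra.
Qed.

Lemma bspline_ge0 t : 0 <= bspline t.
Proof.
rewrite /bspline; have [t0|t0] := leP t 1.
  by rewrite [X in _ - X]smooth_step_left ?subr0; [case/andP: (smooth_step01 t)|lra].
have [t2|t2] := leP 2 t.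
  by rewrite smooth_step_right// subr_ge0; case/andP: (smooth_step01 (t - 1)).
rewrite /smooth_step /parab /ramp.
by rewrite !(@max_l _ _ t 0, @max_l _ _ (t - 1) 0, @max_r _ _ (t - 2) 0,
  @max_r _ _ (t - 1 - 1) 0, @max_r _ _ (t - 1 - 2) 0); nra.
Qed.

Lemma bspline_le1 t : bspline t <= 1.
Proof.
rewrite /bspline; have := smooth_step01 t; have := smooth_step01 (t - 1).
by move=> /andP[? ?] /andP[? ?]; lra.
Qed.

Lemma bspline_norm t : `|bspline t| <= 1.
Proof. by rewrite ger0_norm ?bspline_ge0// bspline_le1. Qed.

Lemma bspline_eq0 t : t <= 0 \/ 3 <= t -> bspline t = 0.
Proof.
rewrite /bspline => -[t0|t3].
  by rewrite !smooth_step_left ?subrr//; lra.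
by rewrite !smooth_step_right ?subrr//; lra.
Qed.

Lemma parab_taylor x y : `|parab y - parab x - (y - x) * ramp x| <= (y - x) ^+ 2.
Proof.
rewrite ler_norml /parab /ramp; have [x0|x0] := leP x 0;
  have [y0|y0] := leP y 0; rewrite ?expr0n/=.
- by have := sqr_ge0 (y - x) => ?; apply/andP; split; lra.
- have := mulr_ge0 (ltW y0) (ltW y0).
  have : 0 <= - x * y by apply: mulr_ge0; rewrite ?oppr_ge0 // ltW.
  have := sqr_ge0 x; rewrite !expr2 => ? ? ?; apply/andP; split; nra.
- have := sqr_ge0 y; have : 0 <= x * - y by apply: mulr_ge0; rewrite ?oppr_ge0 // ltW.
  have := sqr_ge0 x; rewrite !expr2 => ? ? ?; apply/andP; split; nra.
- have := sqr_ge0 (y - x); rewrite !expr2 => ?; apply/andP; split; nra.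
Qed.

(** The derivative of [bspline]: a third difference of [ramp], just as [bspline] is a third
    difference of [parab]. *)
Definition bspline' t : R :=
  ramp t - 3 * ramp (t - 1) + 3 * ramp (t - 2) - ramp (t - 3).

Lemma bspline'_norm t : `|bspline' t| <= 9.
Proof.
rewrite /bspline' /ramp ler_norml; have [a|a] := leP t 0;
  have [b|b] := leP (t - 1) 0; have [c|c] := leP (t - 2) 0;
  have [e|e] := leP (t - 3) 0; apply/andP; split; lra.
Qed.

(** The 8 is [1 + 3 + 3 + 1], the sum of the absolute coefficients of a third difference. *)
Lemma bspline_taylor x y :
  `|bspline y - bspline x - (y - x) * bspline' x| <= 8 * (y - x) ^+ 2.
Proof.
have := parab_taylor x y; have := parab_taylor (x - 1) (y - 1).
have := parab_taylor (x - 2) (y - 2); have := parab_taylor (x - 3) (y - 3).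
have E c : y - c - (x - c) = y - x by ring.
have E1 t : t - 1 - 1 = t - 2 by ring.
have E2 t : t - 1 - 2 = t - 3 by ring.
rewrite !E /bspline /smooth_step /bspline' !E1 !E2.
rewrite !ler_norml => /andP[? ?] /andP[? ?] /andP[? ?] /andP[? ?].
by apply/andP; split; lra.
Qed.

(** For [|y - x| <= 1] the Taylor bound gives [9 + 8]; for larger distances the range of the spline
    suffices. *)
Lemma bspline_lip x y : `|bspline y - bspline x| <= 17 * `|y - x|.
Proof.
have [xy|xy] := leP `|y - x| 1; last first.
  apply: le_trans (ler_normB _ _) _.
  by have := bspline_norm x; have := bspline_norm y; lra.
have -> : bspline y - bspline x = (bspline y - bspline x - (y - x) * bspline' x) +
  (y - x) * bspline' x by ring.
apply: le_trans (ler_normD _ _) _.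
have := bspline_taylor x y; rewrite normrM -[(y - x) ^+ 2]real_normK ?num_real//.
have := bspline'_norm x; have := normr_ge0 (y - x).
by have := normr_ge0 (bspline' x); nra.
Qed.

Lemma bspline_partition (n : nat) t :
  \sum_(i < n) bspline (t - i%:R) = smooth_step t - smooth_step (t - n%:R).
Proof.
elim: n => [|n IH]; first by rewrite big_ord0 subr0 subrr.
rewrite big_ord_recr/= IH /bspline.
have -> : t - n%:R - 1 = t - n.+1%:R by rewrite -natr1; ring.
by ring.
Qed.

End bspline.

(** * Step approximation, and rescaled B-splines as test functions *)

Section test_functions.
Context {R : realType}.
Implicit Types (x y e L M : R) (g : R -> R) (r : seq (R * R)).

Lemma step_fun_cat r1 r2 x : step_fun (r1 ++ r2) x = step_fun r1 x + step_fun r2 x.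
Proof. exact: big_cat. Qed.

(** On each cell of a uniform mesh of [[-M, M]] the approximant takes the value of [g] at the right
    end. A cell []z j, z j.+1]] is a difference of two half-lines, whence the two families in
    [r]. *)
Lemma lipschitz_step_fun g L M : 0 < M ->
  (forall x y, `|g y - g x| <= L * `|y - x|) ->
  (forall x, x <= - M \/ M <= x -> g x = 0) ->
  forall e, 0 < e -> exists r, forall x, `|g x - step_fun r x| <= e.
Proof.
move=> M0 gL g0 e e0.
have L0 : 0 <= L by have := gL 0 1; rewrite subr0 normr1 mulr1; apply: le_trans.
have [n n0 ne] : exists2 n, (0 < n)%N & L * (2 * M) <= e * n%:R.
  exists (Num.truncn (L * (2 * M) / e)).+1 => //.
  by rewrite [leRHS]mulrC -ler_pdivrMr// ltW// truncnS_gt.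
have nR : 0 < n%:R :> R by rewrite ltr0n.
pose h := 2 * M / n%:R; pose z (j : nat) := - M + j%:R * h.
have h0 : 0 < h by rewrite divr_gt0 ?mulr_gt0.
have zS j : z j.+1 = z j + h by rewrite /z -natr1; ring.
have z0 : z 0%N = - M by rewrite /z mul0r addr0.
have zn : z n = M by rewrite /z /h; field; rewrite gt_eqF.
pose r := [seq (g (z j.+1), z j.+1) | j <- iota 0 n] ++
          [seq (- g (z j.+1), z j) | j <- iota 0 n].
exists r => x.
pose one j : R := (x <= z j.+1)%R%:R - (x <= z j)%R%:R.
have stepE : step_fun r x = \sum_(0 <= j < n) g (z j.+1) * one j.
  rewrite step_fun_cat /step_fun !big_map -big_split/= /index_iota subn0.
  by apply: eq_bigr => j _; rewrite /one; ring.
have one0 j : 0 <= one j.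
  rewrite /one zS; have [xz|xz] := leP x (z j); last by rewrite subr0.
  by rewrite (le_trans xz) ?subrr// lerDl ltW.
have sum_one : \sum_(0 <= j < n) one j = (x <= M)%R%:R - (x <= - M)%R%:R.
  by rewrite /one (telescope_sumr (fun j => (x <= z j)%R%:R)) // z0 zn.
(* The cells tile []-M, M]], and [g] vanishes elsewhere. *)
have gE : g x = \sum_(0 <= j < n) g x * one j.
  rewrite -mulr_sumr sum_one.
  have [xM|xM] := leP x (- M); first by rewrite g0 ?mul0r//; left.
  by have [xM'|xM'] := leP x M; rewrite ?subr0 ?mulr1// g0 ?mul0r//; right; exact: ltW.
rewrite stepE gE -sumrB; apply: le_trans (ler_norm_sum _ _ _) _.
apply: (@le_trans _ _ (\sum_(0 <= j < n) L * h * one j)).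
  apply: ler_sum => j _; rewrite -mulrBl normrM [`|one j|]ger0_norm//.
  have [xz|xz] := leP x (z j); last first.
    have [xz'|xz'] := leP x (z j.+1); last first.
      by rewrite /one (lt_geF xz') (lt_geF xz) subrr !mulr0.
    apply: ler_wpM2r => //; apply: le_trans (gL _ _) _; apply: ler_wpM2l => //.
    by rewrite zS in xz' *; rewrite ler_norml; apply/andP; split; lra.
  have -> : one j = 0.
    by rewrite /one xz (le_trans xz) ?subrr// zS lerDl ltW.
  by rewrite !mulr0.
rewrite -mulr_sumr sum_one.
have : L * h <= e by rewrite /h mulrA ler_pdivrMr.
have Lh : 0 <= L * h by rewrite mulr_ge0 // ltW.
apply: le_trans; rewrite -[leRHS]mulr1; apply: ler_wpM2l => //.
by case: (x <= M); case: (x <= - M) => /=; lra.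
Qed.

Lemma bounded_measurable_le d (T : measurableType d) (X : T -> R) x :
  measurable_fun [set: T] X -> bounded_measurable (fun t => (X t <= x)%R%:R : R).
Proof.
move=> mX; have mA : measurable (X @^-1` `]-oo, x]).
  by rewrite -[X in measurable X]setTI; exact: mX.
have := bounded_measurable_indic (R := R) mA; congr bounded_measurable.
apply/funext => t; rewrite indicE; congr (nat_of_bool _)%:R.
by apply/idP/idP; rewrite inE /= in_itv.
Qed.

Lemma mean_le_indic d (T : measurableType d) (P : probability T R) (X : T -> R) x :
  measurable_fun [set: T] X ->
  (mean P (fun t => (X t <= x)%R%:R))%:E = P [set t | X t <= x].
Proof.
move=> mX; have mA : measurable [set t | X t <= x].
  rewrite (_ : mkset _ = X @^-1` `]-oo, x]); last by rewrite set_itvE.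
  by rewrite -[X in measurable X]setTI; exact: mX.
rewrite -(mean_indic P mA); congr (_%:E); apply: eq_mean => t.
by rewrite indicE; congr (nat_of_bool _)%:R; apply/idP/idP; rewrite inE.
Qed.

Lemma bounded_measurable_step d (T : measurableType d) (X : T -> R) r :
  measurable_fun [set: T] X -> bounded_measurable (fun t => step_fun r (X t)).
Proof.
move=> mX; apply: bounded_measurable_sum => q.
by apply: bounded_measurableZ; exact: bounded_measurable_le.
Qed.

Let N : probability (measurableTypeR R) R := normal_prob 0 1.

Lemma mean_step_fun r : mean N (step_fun r) = step_mean r.
Proof.
have mid : measurable_fun [set: measurableTypeR R] (@idfun (measurableTypeR R)).
  exact: measurable_id.
rewrite /step_fun mean_sum => [|q]; last first.
  by apply: bounded_measurableZ; exact: bounded_measurable_le mid.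
apply: eq_bigr => q _; rewrite meanZ; last exact: bounded_measurable_le mid.
congr (_ * _); apply: EFin_inj; rewrite (mean_le_indic N q.2 mid) -PhiE.
by rewrite /std_normal_cdf set_itvE.
Qed.

Lemma measurable_bspline : measurable_fun [set: R] (@bspline R).
Proof.
have mp c : measurable_fun [set: R] (fun t : R => parab (t - c)).
  apply: measurable_funM => //; apply: measurable_funX.
  apply: measurable_maxr => //; exact: measurable_funB.
have ms c : measurable_fun [set: R] (fun t : R => smooth_step (t - c)).
  apply: measurable_funD; first apply: measurable_funB => //.
    apply: measurable_funM => //.
    by have := mp (c + 1); congr measurable_fun; apply/funext => t; congr parab; ring.
  by have := mp (c + 2); congr measurable_fun; apply/funext => t; congr parab; ring.
apply: measurable_funB => //.
by have := ms 0; congr measurable_fun; apply/funext => t; rewrite subr0.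
Qed.

Lemma measurable_bspline_affine (a h : R) :
  measurable_fun [set: R] (fun x : R => bspline (x / h + a)).
Proof.
apply: (measurableT_comp measurable_bspline).
by apply: measurable_funD => //; exact: measurable_funM.
Qed.

Lemma bspline_test_function (a h : R) : 0 < h ->
  test_function (fun x => bspline (x / h + a))
    (mean N (fun x => bspline (x / h + a))).
Proof.
move=> h0; set g := fun x => bspline _.
have mg : measurable_fun [set: measurableTypeR R] g.
  exact: measurable_bspline_affine.
have g1 x : `|g x| <= 1 by exact: bspline_norm.
have bg : bounded_measurable g by split => //; exists 1.
have hV : 0 < h^-1 by rewrite invr_gt0.
have hE x y : y / h + a - (x / h + a) = (y - x) / h by field; rewrite gt_eqF.
have gL x y : `|g y - g x| <= 17 / h * `|y - x|.
  apply: le_trans (bspline_lip _ _) _; rewrite hE normrM [`|h^-1|]gtr0_norm//.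
  by rewrite mulrCA mulrA [_ * `|_|]mulrC mulrA.
split=> //.
- have := mean_dist N bg (bounded_measurable_cst _ 0) (bounded_measurable_cst _ 1).
  by rewrite !mean_cst subr0; apply => t; rewrite subr0.
- exists (fun x => bspline' (x / h + a) / h), (17 / h + 8 / h ^+ 2).
  have h2 : 0 <= 8 / h ^+ 2 by rewrite divr_ge0 ?sqr_ge0.
  have h3 : 0 <= 17 / h by rewrite divr_ge0 ?ltW.
  split=> [x|x y|x y].
  + rewrite normrM [`|h^-1|]gtr0_norm//.
    apply: (@le_trans _ _ (17 / h)); last by rewrite lerDl.
    by rewrite ler_pM2r//; apply: le_trans (bspline'_norm _) _; lra.
  + by apply: le_trans (gL _ _) _; rewrite ler_wpM2r// lerDl.
  + have := bspline_taylor (x / h + a) (y / h + a); rewrite hE -mulrA [h^-1 * _]mulrC.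
    move=> /le_trans; apply.
    have -> : (17 / h + 8 / h ^+ 2) * (y - x) ^+ 2 =
      17 / h * (y - x) ^+ 2 + 8 * ((y - x) / h) ^+ 2 by field; rewrite gt_eqF.
    rewrite lerDr.
    by rewrite mulr_ge0 ?sqr_ge0.
- move=> e e0.
  have M0 : 0 < h * (`|a| + 3) by rewrite mulr_gt0// ltr_wpDl.
  have [|r gr] := lipschitz_step_fun M0 gL _ e0.
    move=> x [xM|Mx]; apply: bspline_eq0; [left|right].
      have : x / h <= - (`|a| + 3) by rewrite ler_pdivrMr// mulNr mulrC.
      by have := ler_norm a; lra.
    have : `|a| + 3 <= x / h by rewrite ler_pdivlMr// mulrC.
    by have := ler_norm (- a); rewrite normrN; lra.
  exists r; split=> //; rewrite -mean_step_fun -[leRHS](mean_cst N).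
  have mid : measurable_fun [set: measurableTypeR R] (@idfun (measurableTypeR R)).
    exact: measurable_id.
  apply: mean_dist => //; first exact: (bounded_measurable_step r mid).
  exact: bounded_measurable_cst.
Qed.

(** The shifted splines sum to 1 on [[-y, y]], so they dominate the indicator of []-y, y]]; the
    margin 2 is the width of the transition of [smooth_step]. *)
Lemma bspline_grid_mean y h n : 0 < h -> y <= h * (n%:R - 2) ->
  Phi y - Phi (- y) <= \sum_(i < 2 * n) mean N (fun x => bspline (x / h + (n%:R - i%:R))).
Proof.
move=> h0 yn.
have mid : measurable_fun [set: measurableTypeR R] (@idfun (measurableTypeR R)).
  exact: measurable_id.
have bg (i : 'I_(2 * n)) : bounded_measurable
    (fun x : measurableTypeR R => bspline (x / h + (n%:R - i%:R))).
  split; first exact: measurable_bspline_affine.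
  by exists 1 => x; exact: bspline_norm.
have -> : Phi y - Phi (- y) = mean N (step_fun [:: (1, y); (-1, - y)]).
  by rewrite mean_step_fun /step_mean !big_cons big_nil /=; ring.
rewrite -mean_sum//; apply: mean_le.
- exact: (bounded_measurable_step _ mid).
- exact: bounded_measurable_sum.
move=> x; rewrite /step_fun !big_cons big_nil /= addr0 mul1r mulN1r.
set S := \sum_(_ < _) _.
have S0 : 0 <= S by apply: sumr_ge0 => i _; exact: bspline_ge0.
have [xy|xy] := leP x y; last by case: (x <= - y) => /=; lra.
have [xy'|xy'] := leP x (- y); first by rewrite subrr.
have -> : S = \sum_(i < 2 * n) bspline (x / h + n%:R - i%:R).
  by apply: eq_bigr => i _; rewrite addrA.
rewrite bspline_partition.
have yh : y / h <= n%:R - 2 by rewrite ler_pdivrMr// mulrC.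
have xh : x / h <= y / h by rewrite ler_pM2r ?invr_gt0.
have xh' : - (y / h) <= x / h by rewrite -mulNr ler_pM2r ?invr_gt0// ltW.
have -> : x / h + n%:R - (2 * n)%:R = x / h - n%:R by rewrite natrM; ring.
by rewrite smooth_step_right ?smooth_step_left ?subr0//; lra.
Qed.

End test_functions.

(** * Means of functions of independent variables, Gaussian or Bernoulli *)

Section independent_laws.
Context {R : realType} d (T : measurableType d) (P : probability T R).
Context (I : finType) (X : I -> T -> R).
Hypothesis mX : forall i, measurable_fun [set: T] (X i).
Hypothesis indX : mutually_independent P X.

Let joint (J : {set I}) (A : I -> set R) : set T :=
  [set t | forall i, i \in J -> A i (X i t)].

Let measurable_joint J A : (forall i, measurable (A i)) -> measurable (joint J A).
Proof.
move=> mA.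
have -> : joint J A = \bigcap_(i in [set i | i \in J]) (X i @^-1` A i) by [].
apply: fin_bigcap_measurable => [|i _]; first exact: finite_finset.
by rewrite -[X in measurable X]setTI; exact: mX.
Qed.

(** Independence is a statement about events, so the induction carries a mixed product [W]:
    indicators of events for the indices in [J], test functions for those in [s]. Approximating
    [g j] by half-line indicators moves [j] from [s] to [J]; once [s] is empty the product rule for
    events applies. *)
Lemma mean_prod_gaussian (g : I -> R -> R) (c : I -> R) (s : seq I) :
  (forall i (A : set R), measurable A -> P [set t | A (X i t)] = normal_prob 0 1 A) ->
  (forall i, measurable_fun [set: R] (g i)) ->
  (forall i, test_function (g i) (c i)) -> uniq s ->
  mean P (fun t => \prod_(i <- s) g i (X i t)) = \prod_(i <- s) c i.
Proof.
move=> gauX mg gc us.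
pose W J A s t := (\1_(joint J A) t : R) * \prod_(i <- s) g i (X i t).
suff key : forall (J : {set I}) (A : I -> set R), (forall i, measurable (A i)) ->
    (forall i, i \in s -> i \notin J) ->
    mean P (W J A s) =
    (\prod_(i in J) fine (P (X i @^-1` A i))) * \prod_(i <- s) c i.
  have := key (@finset.set0 I) (fun=> [set: R]); rewrite big_set0 mul1r => <-//; last first.
    by move=> i _; rewrite inE.
  apply: eq_mean => t; by rewrite /W indicE mem_set ?mul1r.
have bg i : bounded_measurable (fun t => g i (X i t)).
  have [g1 _ _ _] := gc i; exact: (bounded_measurable_comp (mX i) (mg i) g1).
have bW J A s' : (forall i, measurable (A i)) -> bounded_measurable (W J A s').
  move=> mA; apply: bounded_measurableM; last exact: bounded_measurable_prod.
  exact/bounded_measurable_indic/measurable_joint.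
have W1 J A s' t : `|W J A s' t| <= 1.
  rewrite /W normrM -[leRHS]mulr1; apply: ler_pM => //.
    by rewrite indicE; case: (_ \in _); rewrite ?normr1 ?normr0.
  rewrite normr_prod; apply: prodr_ile1 => i _; rewrite normr_ge0/=.
  by have [-> _ _ _] := gc i.
elim: s us => [_|j s IH /= /andP[js us]] J A mA sJ.
  rewrite big_nil mulr1; apply: EFin_inj.
  transitivity (P (joint J A)).
    rewrite -(mean_indic P (measurable_joint J mA)); congr (_%:E).
    by apply: eq_mean => t; rewrite /W big_nil mulr1.
  rewrite (indX J mA) -prodEFin; apply: eq_bigr => i _.
  by rewrite fineK// fin_num_measure// -[X in measurable X]setTI; exact: mX.
have jJ : j \notin J by apply: sJ; rewrite inE eqxx.
set pJ := \prod_(i in J) _; rewrite big_cons; set C := \prod_(i <- s) c i.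
have pJC : `|pJ * C| <= 1.
  rewrite normrM -[leRHS]mulr1; apply: ler_pM => //; rewrite normr_prod;
    apply: prodr_ile1 => i _; rewrite normr_ge0/=.
    rewrite ger0_norm ?fine_ge0 ?measure_ge0// -lee_fin fineK ?probability_le1//.
      by rewrite -[X in measurable X]setTI; exact: mX.
    by rewrite fin_num_measure// -[X in measurable X]setTI; exact: mX.
  by have [_ -> _ _] := gc i.
have stepW x : mean P (fun t => (X j t <= x)%R%:R * W J A s t) = Phi x * (pJ * C).
  pose A' i : set R := if i == j then `]-oo, x]%classic else A i.
  have mA' i : measurable (A' i) by rewrite /A'; case: ifP.
  have := IH us (j |: J)%SET A' mA' _; rewrite big_setU1//=.
  rewrite (_ : fine (P (X j @^-1` A' j)) = Phi x); last first.
    by rewrite /A' eqxx [P _](gauX j `]-oo, x]%classic).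
  rewrite (_ : \prod_(i in J) _ = pJ); last first.
    apply: eq_bigr => i iJ; rewrite /A'; case: eqP => // ij.
    by move: jJ; rewrite -ij iJ.
  rewrite -mulrA => <-; last first.
    move=> i is_; rewrite !inE negb_or sJ ?inE ?is_ ?orbT// andbT.
    by apply: contraNneq js => <-.
  apply: eq_mean => t; rewrite /W mulrA; congr (_ * _).
  rewrite !indicE -natrM mulnb; congr (nat_of_bool _)%:R.
  apply/andP/idP => [[xt]|].
    rewrite !inE => JA i; rewrite !inE /A'; case: eqP => [-> _|_ /= /JA//].
    by rewrite /= in_itv.
  rewrite inE => JA; split.
    by have := JA j; rewrite /A' !inE eqxx /= in_itv/=; apply.
  rewrite inE => i iJ; have := JA i; rewrite /A' !inE iJ orbT => /(_ isT).
  by case: eqP => // ij; move: jJ; rewrite -ij iJ.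
have [_ _ _ gr] := gc j.
apply/eqP; rewrite -subr_eq0 -normr_le0; apply/ler_addgt0Pr => e e0; rewrite add0r.
have [r [gr1 cr]] := gr _ (divr_gt0 e0 (ltr0n _ 2)).
have bs : bounded_measurable (fun t => step_fun r (X j t)).
  exact: bounded_measurable_step.
have stepE : mean P (fun t => step_fun r (X j t) * W J A s t) =
    step_mean r * (pJ * C).
  transitivity (mean P (fun t => \sum_(q <- r) q.1 * ((X j t <= q.2)%R%:R * W J A s t))).
    apply: eq_mean => t; rewrite /step_fun mulr_suml.
    by apply: eq_bigr => q _; rewrite mulrA.
  have bq (q : R * R) : bounded_measurable (fun t => (X j t <= q.2)%R%:R * W J A s t).
    by apply: bounded_measurableM (bW _ _ _ mA); exact: bounded_measurable_le.
  rewrite mean_sum => [|q]; last exact: bounded_measurableZ.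
  rewrite /step_mean mulr_suml; apply: eq_bigr => q _.
  by rewrite meanZ// stepW mulrA.
have -> : mean P (W J A (j :: s)) - pJ * (c j * C) =
    (mean P (W J A (j :: s)) - mean P (fun t => step_fun r (X j t) * W J A s t)) -
    (c j - step_mean r) * (pJ * C) by rewrite stepE; ring.
apply: le_trans (ler_normB _ _) _.
have -> : e = e / 2 + e / 2 by field.
apply: lerD; last by rewrite normrM -[leRHS]mulr1; exact: ler_pM.
rewrite -[leRHS](mean_cst P); apply: mean_dist.
- exact: bW.
- exact: bounded_measurableM (bW _ _ _ mA).
- exact: bounded_measurable_cst.
move=> t; have -> : W J A (j :: s) t - step_fun r (X j t) * W J A s t =
    (g j (X j t) - step_fun r (X j t)) * W J A s t.
  by rewrite /W big_cons; ring.
by rewrite normrM -[leRHS]mulr1; exact: ler_pM.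
Qed.

(** The variables are 0 or 1 only almost surely. [S] is the indicator of the event that all of them
    are; its mean is 1, so the values of [h] elsewhere, bounded by [M], cost at most [M] times the
    mean of [1 - S], which is 0. *)
Lemma mean_bernoulli_law (p : R) (h : T -> R) (F : {ffun I -> bool} -> R) :
  0 < p < 1 ->
  (forall i, P [set t | X i t = 1] = p%:E) ->
  (forall i, P [set t | X i t = 0] = (1 - p)%:E) ->
  bounded_measurable h ->
  (forall (b : {ffun I -> bool}) t, (forall i, X i t = (b i)%:R) -> h t = F b) ->
  mean P h = Ex p F.
Proof.
move=> p01 X1 X0 bh hF.
pose E (b : {ffun I -> bool}) := joint [set: I]%SET (fun i => [set (b i)%:R]).
have mE b : measurable (E b) by exact: measurable_joint.
have PE b : mean P (\1_(E b)) = cube_weight p b.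
  apply: EFin_inj; rewrite (mean_indic P (mE b)).
  transitivity (\prod_(i in [set: I]%SET) P (X i @^-1` [set (b i)%:R]))%E.
    by apply: indX => i; exact: measurable_set1.
  rewrite /cube_weight -prodEFin; apply: eq_big => [i|i _]; first by rewrite inE.
  rewrite /bern_weight.
  by case: (b i); [exact: X1|exact: X0].
have bE b : bounded_measurable (\1_(E b) : T -> R) by exact: bounded_measurable_indic.
pose S t : R := \sum_b \1_(E b) t.
have bS : bounded_measurable S by exact: bounded_measurable_sum.
have disj b t : E b t -> S t = 1.
  move=> bt; rewrite /S (bigD1 b)//= indicE mem_set// big1 ?addr0// => b' b'b.
  rewrite indicE memNset// => b't; move/eqP: b'b; apply; apply/ffunP => i.
  have := bt i; have := b't i; rewrite !inE => /(_ isT) -> /(_ isT) /eqP.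
  by rewrite eqr_nat; case: (b i); case: (b' i).
have S01 t : S t = 0 \/ exists b, E b t.
  have [[b bt]|nE] := pselect (exists b, E b t); [by right; exists b|left].
  by apply: big1 => b _; rewrite indicE memNset// => bt; apply: nE; exists b.
have [_ [M hM]] := bh.
have FE : mean P (fun t => \sum_b F b * \1_(E b) t) = Ex p F.
  rewrite mean_sum => [|b]; last exact: bounded_measurableZ.
  by apply: eq_bigr => b _; rewrite meanZ// PE mulrC.
have meanS : mean P S = 1.
  rewrite /S mean_sum// -[RHS](Ex_cst p I 1); apply: eq_bigr => b _.
  by rewrite PE mulr1.
apply/eqP; rewrite -FE -subr_eq0 -normr_le0.
rewrite [leRHS](_ : 0 = mean P (fun t => M * (1 - S t))); last first.
  rewrite meanZ; last exact: bounded_measurableB (bounded_measurable_cst _ _) bS.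
  by rewrite meanB ?mean_cst ?meanS ?subrr ?mulr0//; exact: bounded_measurable_cst.
apply: mean_dist => //.
- by apply: bounded_measurable_sum => b; exact: bounded_measurableZ.
- by apply: bounded_measurableZ; exact: bounded_measurableB (bounded_measurable_cst _ _) bS.
move=> t; have [St|[b bt]] := S01 t.
  rewrite St subr0 mulr1 big1 ?subr0// => b _.
  have := St; rewrite /S => /eqP; rewrite psumr_eq0 => [|b' _]; last by rewrite indicE.
  by move=> /allP/(_ b (mem_index_enum _))/eqP ->; rewrite mulr0.
rewrite (disj b)// subrr mulr0 (bigD1 b)//= indicE mem_set// mulr1.
rewrite big1 => [|b' b'b]; last first.
  have := disj b t bt; rewrite /S (bigD1 b)//= indicE mem_set// => /eqP.
  rewrite -subr_eq0 addrAC subrr add0r psumr_eq0 => [/allP|b'' _]; last by rewrite indicE.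
  by move=> /(_ b' (mem_index_enum _)); rewrite b'b => /eqP ->; rewrite mulr0.
rewrite addr0 (hF b) ?subrr ?normr0// => i; exact: (bt i (finset.in_setT i)).
Qed.

End independent_laws.

(** * Spline interpolation of functions of a matrix *)

Section grid.
Context {R : realType} (r l : nat).
Local Notation D := ('I_r * 'I_l)%type.
Implicit Types (A Y : 'M[R]_(r, l)) (g : 'M[R]_(r, l) -> R) (h e M : R) (n : nat).

Definition grid_node n h (f : {ffun D -> 'I_(2 * n)}) : 'M[R]_(r, l) :=
  \matrix_(i, j) (h * ((f (i, j))%:R - n%:R)).

(** A tensor product B-spline supported on the cube of side [3 * h] that has [grid_node h f] as its
    lowest corner. *)
Definition grid_bump n h (f : {ffun D -> 'I_(2 * n)}) A : R :=
  \prod_(a : D) bspline (A a.1 a.2 / h + (n%:R - (f a)%:R)).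

Definition grid_cover n h A : R := \sum_f @grid_bump n h f A.

Definition grid_interp n h g A : R :=
  \sum_f g (@grid_node n h f) * @grid_bump n h f A.

Lemma grid_bump_ge0 n h f A : 0 <= @grid_bump n h f A.
Proof. by apply: prodr_ge0 => a _; exact: bspline_ge0. Qed.

Lemma grid_bump_near n h f A : 0 < h -> @grid_bump n h f A != 0 ->
  forall i j, `|A i j - @grid_node n h f i j| < 4 * h.
Proof.
move=> h0 fA i j; rewrite mxE.
have {fA} : bspline (A i j / h + (n%:R - (f (i, j))%:R)) != 0.
  by apply: contra_neq fA => fA; rewrite /grid_bump (bigD1 (i, j))//= fA mul0r.
set t := A i j / h + _ => t0.
have -> : A i j - h * ((f (i, j))%:R - n%:R) = h * t.
  by rewrite /t; field; rewrite gt_eqF.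
rewrite normrM gtr0_norm// [_ * h]mulrC ltr_pM2l//.
have [t1|t1] := leP t 0; first by rewrite bspline_eq0 ?eqxx in t0; last by left.
have [t3|t3] := leP 3 t; first by rewrite bspline_eq0 ?eqxx in t0; last by right.
by rewrite gtr0_norm//; lra.
Qed.

Lemma grid_coverE n h A :
  @grid_cover n h A =
  \prod_(a : D) \sum_(i < 2 * n) bspline (A a.1 a.2 / h + (n%:R - i%:R)).
Proof.
by rewrite (bigA_distr_bigA (fun a (i : 'I_(2 * n)) =>
  bspline (A a.1 a.2 / h + (n%:R - i%:R)))).
Qed.

Lemma bspline_sum n (t : R) : \sum_(i < 2 * n) bspline (t + (n%:R - i%:R)) =
  smooth_step (t + n%:R) - smooth_step (t - n%:R).
Proof.
transitivity (\sum_(i < 2 * n) bspline (t + n%:R - i%:R)).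
  by apply: eq_bigr => i _; rewrite addrA.
by rewrite bspline_partition natrM; congr (_ - smooth_step _); ring.
Qed.

Lemma bspline_sum01 n (t : R) :
  0 <= \sum_(i < 2 * n) bspline (t + (n%:R - i%:R)) <= 1.
Proof.
apply/andP; split; first by apply: sumr_ge0 => i _; exact: bspline_ge0.
rewrite bspline_sum; have := smooth_step01 (t + n%:R).
by have := smooth_step01 (t - n%:R) => /andP[? ?] /andP[? ?]; lra.
Qed.

Lemma grid_cover01 n h A : 0 <= @grid_cover n h A <= 1.
Proof.
rewrite grid_coverE; apply/andP; split.
  by apply: prodr_ge0 => a _; case/andP: (bspline_sum01 n (A a.1 a.2 / h)).
by apply: prodr_ile1 => a _; exact: bspline_sum01.
Qed.

Lemma grid_cover1 n h A : 0 < h -> (forall i j, `|A i j| <= h * (n%:R - 2)) ->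
  @grid_cover n h A = 1.
Proof.
move=> h0 An; rewrite grid_coverE big1// => -[i j] _ /=; rewrite bspline_sum.
have := An i j; rewrite ler_norml => /andP[]; rewrite -mulrN.
move=> h1 h2.
have {}h1 : - (n%:R - 2) <= A i j / h by rewrite ler_pdivlMr// mulrC.
have {}h2 : A i j / h <= n%:R - 2 by rewrite ler_pdivrMr// mulrC.
by rewrite smooth_step_right ?smooth_step_left ?subr0//; lra.
Qed.

(** The bumps are nonnegative with total at most 1: they average the local errors of [g], and the
    mass they miss at [A] is paid with the bound [M]. *)
Lemma grid_interp_dist n h g A e M : 0 <= e ->
  (forall Y, `|g Y| <= M) ->
  (forall f, @grid_bump n h f A != 0 -> `|g A - g (@grid_node n h f)| <= e) ->
  `|g A - @grid_interp n h g A| <= e + M * (1 - @grid_cover n h A).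
Proof.
move=> e0 gM ge; have /andP[c0 c1] := grid_cover01 n h A.
have M0 : 0 <= M by apply: le_trans (gM 0).
have -> : g A - @grid_interp n h g A = g A * (1 - @grid_cover n h A) +
    \sum_f (g A - g (@grid_node n h f)) * @grid_bump n h f A.
  rewrite (eq_bigr (fun f => g A * @grid_bump n h f A -
    g (@grid_node n h f) * @grid_bump n h f A)); last by move=> f _; rewrite mulrBl.
  by rewrite sumrB -mulr_sumr -/(grid_cover n h A) -/(grid_interp n h g A); ring.
rewrite addrC; apply: le_trans (ler_normD _ _) _; apply: lerD; last first.
  by rewrite normrM [`|1 - _|]ger0_norm ?subr_ge0// ler_wpM2r ?subr_ge0.
apply: le_trans (ler_norm_sum _ _ _) _.
apply: (@le_trans _ _ (\sum_f e * @grid_bump n h f A)).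
  apply: ler_sum => f _; rewrite normrM [`|@grid_bump _ _ _ _|]ger0_norm ?grid_bump_ge0//.
  have [->|fA] := eqVneq (@grid_bump n h f A) 0; first by rewrite !mulr0.
  by rewrite ler_wpM2r ?grid_bump_ge0// ge.
by rewrite -mulr_sumr ler_piMr.
Qed.

Lemma mx_continuous_ball g A e : {for A, continuous g} -> 0 < e ->
  exists2 h : R, 0 < h & forall Y, (forall i j, `|A i j - Y i j| < h) -> `|g A - g Y| < e.
Proof.
move=> /cvgrPdist_lt/(_ _) ge e0; have /nbhs_ballP[h /= h0 hg] := ge e e0.
by exists h => // Y AY; apply: hg; split => // i j; exact: AY.
Qed.

(** Compactness of the box, with matrices flattened to row vectors so that it becomes a product of
    segments. Only [Y] is confined to the box, since in the application [Y] is a grid node. *)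
Lemma mx_uniformly_continuous_box g (b e : R) : continuous g -> 0 < e ->
  exists2 h : R, 0 < h & forall A Y, (forall i j, `|Y i j| <= b) ->
    (forall i j, `|A i j - Y i j| < h) -> `|g A - g Y| <= e.
Proof.
move=> cg e0.
pose K := [set v : 'rV[R]_(r * l) | forall i, `[- b, b]%classic (v ord0 i)].
have cK : compact K.
  by apply: (@rV_compact R _ (fun=> `[- b, b]%classic)) => _; exact: segment_compact.
pose Q (h : R) (v : 'rV[R]_(r * l)) := forall A,
  (forall i j, `|A i j - vec_mx v i j| < h) -> `|g A - g (vec_mx v)| <= e.
have := (compact_near_coveringP K).1 cK R (0^'+) Q _.
have loc (v : 'rV[R]_(r * l)) : K v -> \forall v' \near v & h \near 0^'+, Q h v'.
  move=> _; have e2 : 0 < e / 2 by rewrite divr_gt0.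
  have [h h0 hg] := mx_continuous_ball (cg (vec_mx v)) e2.
  have h2 : 0 < h / 2 by rewrite divr_gt0.
  exists (ball v (h / 2), [set h' | h' < h / 2]) => /=.
    by split; [exact: nbhsx_ballx|exact: nbhs_right_lt].
  move=> [v' h'] /= [[_ vv'] hh'] A Av'.
  have d1 i j : `|vec_mx v i j - vec_mx v' i j| < h / 2.
    by rewrite !mxE; exact: vv'.
  have d2 i j : `|vec_mx v i j - A i j| < h.
    rewrite -(subrK (vec_mx v' i j) (vec_mx v i j)) -addrA.
    apply: le_lt_trans (ler_normD _ _) _; rewrite (splitr h) ltrD//.
    by rewrite distrC; exact: lt_trans (Av' i j) hh'.
  have g1 := hg _ d2.
  have g2 : `|g (vec_mx v) - g (vec_mx v')| < e / 2.
    apply: hg => i j; apply: lt_le_trans (d1 i j) _.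
    by rewrite ler_pdivrMr// ler_peMr ?ltW// ltr1n.
  move: g1 g2; rewrite !ltr_norml ler_norml => /andP[? ?] /andP[? ?].
  by apply/andP; split; lra.
move=> /(_ _ loc) [h /= h0 hK].
exists (h / 2); first by rewrite divr_gt0.
move=> A Y Yb AY.
have := hK (h / 2); rewrite /= sub0r normrN gtr0_norm ?divr_gt0//.
have hh : h / 2 < h by rewrite ltr_pdivrMr// ltr_pMr// ltr1n.
move=> /(_ hh) /(_ _)/(_ (mxvec Y)); rewrite /Q mxvecK; apply => //.
move=> k; case/mxvec_indexP: k => i j; rewrite mxvecE /= in_itv/=.
by rewrite -ler_norml.
Qed.

Lemma measurable_grid_bump d (T : measurableType d) (X : T -> 'M[R]_(r, l)) n h f :
  random_matrix X -> bounded_measurable (fun t => @grid_bump n h f (X t)).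
Proof.
move=> mX; apply: bounded_measurable_prod => a.
apply: (bounded_measurable_comp (mX a.1 a.2) (measurable_bspline_affine _ h)) => x.
exact: bspline_norm.
Qed.

Lemma measurable_grid_interp d (T : measurableType d) (X : T -> 'M[R]_(r, l)) n h g :
  random_matrix X -> bounded_measurable (fun t => @grid_interp n h g (X t)).
Proof.
move=> mX; apply: bounded_measurable_sum => f.
by apply: bounded_measurableZ; exact: measurable_grid_bump.
Qed.

(** Only the entries of [X] are known to be measurable, so [g] is reached as a pointwise limit of
    its spline interpolants. *)
Lemma measurable_continuous_mx d (T : measurableType d) (X : T -> 'M[R]_(r, l)) g M :
  random_matrix X -> continuous g -> (forall Y, `|g Y| <= M) ->
  bounded_measurable (fun t => g (X t)).
Proof.
move=> mX cg gM; split; last by exists M.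
(* The mesh tends to 0 while the covered radius [h k * (n k - 2) = k + 1] tends to infinity. *)
pose h (k : nat) : R := k.+1%:R^-1; pose n (k : nat) := (k.+1 * k.+1 + 2)%N.
apply: (@measurable_fun_cvg _ _ _ _ (fun k t => @grid_interp (n k) (h k) g (X t))).
  by move=> k; case: (measurable_grid_interp (n k) (h k) g mX).
move=> t _; apply/cvgrPdist_le => e e0.
have [eta eta0 etag] := mx_continuous_ball (cg (X t)) e0.
have h0 k : 0 < h k by rewrite invr_gt0.
near=> k.
have cov : @grid_cover (n k) (h k) (X t) = 1.
  apply: grid_cover1 => // i j; rewrite /h /n natrD addrK natrM mulKf ?pnatr_eq0//.
  move: i j; near: k.
  have [b Xb] : exists b : nat, forall i j, `|X t i j| <= b%:R.
    exists (\max_(a : D) Num.truncn `|X t a.1 a.2|).+1 => i j.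
    apply/ltW; apply: lt_le_trans (truncnS_gt _) _; rewrite ler_nat ltnS.
    exact: (leq_bigmax (i, j)).
  exists b => // k /= bk i j; apply: le_trans (Xb i j) _.
  by rewrite ler_nat ltnW.
have := @grid_interp_dist (n k) (h k) g (X t) e M (ltW e0) gM.
rewrite cov subrr mulr0 addr0; apply => f fX; apply/ltW/etag => i j.
apply: lt_le_trans (grid_bump_near (h0 k) fX i j) _.
rewrite /h ler_pdivrMr//; near: k.
exists (Num.truncn (4 / eta)) => // k /= bk.
rewrite mulrC -ler_pdivrMr//; apply/ltW; apply: lt_le_trans (truncnS_gt _) _.
by rewrite ler_nat ltnS.
Unshelve. all: by end_near. Qed.

End grid.

(** * The two convergence statements *)

Section orthogonal_directions.
Context {R : realType} (p : R) (p01 : 0 < p < 1).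

(* The coefficients of [(U *m Om) a.1 a.2] in the entries of [Om]. *)
Definition entry_coef (n l : nat) (U : 'M[R]_n) (a : 'I_n * 'I_l)
  (k : 'I_n * 'I_l) : R := U a.1 k.1 * (a.2 == k.2)%:R.

Lemma entry_coef_sum (n l : nat) (U : 'M[R]_n) (a : 'I_n * 'I_l)
    (F : R -> 'I_n * 'I_l -> R) : (forall k, F 0 k = 0) ->
  \sum_k F (entry_coef U a k) k = \sum_k F (U a.1 k) (k, a.2).
Proof.
move=> F0; transitivity (\sum_k \sum_j F (entry_coef U a (k, j)) (k, j)).
  by rewrite pair_bigA; apply: eq_bigr => -[].
apply: eq_bigr => k _; rewrite (bigD1 a.2)//= /entry_coef/= eqxx mulr1.
by rewrite big1 ?addr0// => j /negPf ja; rewrite eq_sym ja mulr0.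
Qed.

Lemma entry_coef_dot (n l : nat) (U : 'M[R]_n) (a a' : 'I_n * 'I_l) :
  orthogonal_matrix U ->
  \sum_k entry_coef U a k * entry_coef U a' k = (a == a')%:R.
Proof.
(* The definition of orthogonality concerns the columns of [U]; the coefficient vectors are made of
   its rows. *)
move=> /mulmx1C UU.
rewrite (entry_coef_sum U a (F := fun u k => u * entry_coef U a' k)); last first.
  by move=> k; rewrite mul0r.
rewrite /entry_coef/=; under eq_bigr do rewrite mulrA.
rewrite -mulr_suml.
have -> : \sum_k U a.1 k * U a'.1 k = (a.1 == a'.1)%:R.
  have /matrixP/(_ a.1 a'.1) := UU; rewrite !mxE => <-.
  by apply: eq_bigr => k _; rewrite mxE.
by rewrite -natrM mulnb [a'.2 == _]eq_sym -xpair_eqE -!surjective_pairing.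
Qed.

Lemma cubes_entry_coef (n l : nat) (U : 'M[R]_n) (a : 'I_n * 'I_l) :
  cubes (entry_coef U a) = \sum_k `|U a.1 k| ^+ 3.
Proof.
rewrite /cubes (entry_coef_sum U a (F := fun u _ => `|u| ^+ 3))// => k.
by rewrite normr0 expr0n.
Qed.

Lemma entry_coef_le (n l : nat) (U : 'M[R]_n) (a k : 'I_n * 'I_l) :
  `|entry_coef U a k| <= `|U a.1 k.1|.
Proof.
by rewrite /entry_coef; case: eqP => _; rewrite ?mulr1// mulr0 normr0.
Qed.

Context d (T : measurableType d) (P : probability T R) (n l : nat).
Context (Om : T -> 'M[R]_(n, l)) (U : 'M[R]_n).
Hypothesis stdOm : standardized_bernoulli_matrix P p Om.

Lemma random_matrix_mulmx : random_matrix (fun t => U *m Om t).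
Proof.
have [B [mB _ _ _] OmE] := stdOm; move=> i j.
rewrite (_ : (fun t => _) = fun t => \sum_k U i k * ((B t k j - p) / bern_sd p)).
  apply: measurable_sum => k; apply: measurable_funM => //.
  by apply: measurable_funM => //; apply: measurable_funB => //; exact: mB.
by apply/funext => t; rewrite mxE; apply: eq_bigr => k _; rewrite OmE.
Qed.

Lemma mean_mulmx_bernoulli (h : 'M[R]_(n, l) -> R) :
  bounded_measurable (fun t => h (U *m Om t)) ->
  mean P (fun t => h (U *m Om t)) =
  Ex p (fun b => h (\matrix_(i, j) lin p (entry_coef U (i, j)) b)).
Proof.
have [B [mB iB B1 B0] OmE] := stdOm => bh.
apply: (mean_bernoulli_law (X := fun ij t => B t ij.1 ij.2)) => //.
move=> b t Bb; congr h; apply/matrixP => i j; rewrite !mxE.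
rewrite /lin (entry_coef_sum U (i, j) (F := fun u k => u * bern_std p (b k))); last first.
  by move=> k; rewrite mul0r.
by apply: eq_bigr => k _; rewrite OmE (Bb (k, j)).
Qed.

Hypothesis orthU : orthogonal_matrix U.

Lemma berry_esseen_entry (i : 'I_n) (j : 'I_l) :
  (kolmogorov_distance
     (fun x : R => P [set t | ((U *m Om t) i j <= x)%R]) (@std_normal_cdf R)
   <= ((5 + @stein_bound R) / bern_sd p * \sum_k `|U i k| ^+ 3)%:E)%E.
Proof.
apply: ge_ereal_sup => _ [x _ <-].
have mX := random_matrix_mulmx i j.
rewrite -(mean_le_indic P x mX) PhiE -EFinB abse_EFin lee_fin.
rewrite (mean_mulmx_bernoulli (h := fun A => (A i j <= x)%R%:R)); last first.
  exact: bounded_measurable_le.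
rewrite (_ : Ex p _ = Ex p (fun b => (lin p (entry_coef U (i, j)) b <= x)%R%:R)); last first.
  by apply: eq_Ex => b; rewrite mxE.
rewrite -(cubes_entry_coef U (i, j)); apply: berry_esseen_cube => //.
have := entry_coef_dot (i, j) (i, j) orthU; rewrite eqxx mulr1n => <-.
by apply: eq_bigr.
Qed.

End orthogonal_directions.

(** Weierstrass' product inequality; it bounds the Gaussian mass of the grid from below by
    one-dimensional masses. *)
Lemma prod_ge1B (R : realDomainType) (J : Type) (s : seq J) (x : J -> R) :
  (forall j, 0 <= x j <= 1) -> 1 - \sum_(j <- s) (1 - x j) <= \prod_(j <- s) x j.
Proof.
move=> x01; elim: s => [|j s IH]; first by rewrite !big_nil subr0.
rewrite !big_cons; have /andP[x0 x1] := x01 j.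
have : \prod_(j <- s) x j <= 1 by apply: prodr_ile1 => i _.
have : 0 <= \sum_(j <- s) (1 - x j).
  by apply: sumr_ge0 => i _; rewrite subr_ge0; case/andP: (x01 i).
by nra.
Qed.

Lemma cvg_standardized_bernoulli (R : realType) (p : R) (p01 : 0 < p < 1)
    (l : nat) (d : nat -> measure_display)
    (T : forall n, measurableType (d n)) (P : forall n, probability (T n) R)
    (Om : forall n, T n -> 'M[R]_(n.+1, l))
    (U : forall n, 'M[R]_n.+1) (eps : nat -> R) :
  (forall n, standardized_bernoulli_matrix (P n) p (Om n)) ->
  (forall n, orthogonal_matrix (U n)) ->
  (forall n i j, `|U n i j| <= eps n.+1) ->
  eps @ \oo --> (0 : R) ->
  cvg_to_standard_gaussian P (fun n t => U n *m Om n t).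
Proof.
move=> stdOm orthU Ueps eps0 r rho rho_inj d' S Q Z [mZ iZ gaussZ] g cg [M gM].
pose X n t := rowsub (rho n) (U n *m Om n t).
have mX n : random_matrix (X n).
  move=> i j; rewrite (_ : (fun t => _) = fun t => (U n *m Om n t) (rho n i) j).
    exact: (random_matrix_mulmx (U n) (stdOm n)).
  by apply/funext => t; rewrite mxE.
have bgX n : bounded_measurable (fun t => g (X n t)) by exact: measurable_continuous_mx.
have bgZ : bounded_measurable (fun t => g (Z t)) by exact: measurable_continuous_mx.
have -> : (fun n => 'E_(P n)[g \o X n]%E) =
    EFin \o (fun n => mean (P n) (fun t => g (X n t))).
  by apply/funext => n; rewrite /= -(expectationE (P n) (bgX n)).
rewrite (expectationE Q bgZ); apply: cvg_EFin.
  by near=> n.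
apply/cvgrPdist_le => e e0.
pose N : probability (measurableTypeR R) R := normal_prob 0 1.
(* Interpolation costs at most [3 * e'] for [X n] and [2 * e'] for [Z], and comparing the
   interpolants costs [e']; 8 leaves room. *)
pose e' := e / 8; have e'0 : 0 < e' by rewrite divr_gt0.
have M0 : 0 <= M by apply: le_trans (gM 0).
pose D := ('I_r * 'I_l)%type.
have MD0 : 0 < M * #|{: D}|%:R + 1 by rewrite ltr_wpDl// mulr_ge0.
(* Each coordinate misses a Gaussian mass of at most [2 * ka], so all of them together cost at most
   [M * #|D| * 2 * ka <= e']. *)
pose ka := e' / (2 * (M * #|{: D}|%:R + 1)).
have ka0 : 0 < ka by rewrite divr_gt0// mulr_gt0.
have [y [y0 yl yr]] : exists y : R, [/\ 0 < y, Phi (- y) < ka & 1 - Phi y < ka].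
  have [z zl] : exists z : R, Phi z < ka.
    by near (-oo_R) => z; exists z; near: z; exact: Phi_left.
  near (+oo_R) => y; exists y; split.
  - by near: y; apply: nbhs_pinfty_gt; rewrite num_real.
  - apply: le_lt_trans zl; apply: Phi_homo; rewrite lerNl; apply/ltW.
    by near: y; apply: nbhs_pinfty_gt; rewrite num_real.
  - by near: y; exact: Phi_right.
have [eta eta0 etag] := mx_uniformly_continuous_box (y + 3) cg e'0.
(* A bump reaches less than [4 * h] from its node, and [h <= 1] keeps all nodes in the box of radius
   [y + 3] on which [eta] was chosen. *)
pose h := Num.min 1 (eta / 4).
have h0 : 0 < h by rewrite lt_min ltr01 divr_gt0.
have h1 : h <= 1 by rewrite ge_min lexx.
have heta : 4 * h <= eta by rewrite mulrC -ler_pdivlMr// ge_min lexx orbT.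
pose m := (Num.truncn (y / h) + 3)%N.
have m_lo : y <= h * (m%:R - 2).
  rewrite mulrC -ler_pdivrMr// /m natrD -addrA (_ : 3 - 2 = 1); last by ring.
  by rewrite natr1; apply/ltW; exact: truncnS_gt.
have m_hi : h * m%:R <= y + 3.
  rewrite /m natrD mulrDr lerD//; last by rewrite mulrC ler_piMr.
  by rewrite mulrC -ler_pdivlMr// truncn_le// divr_ge0// ltW.
pose c (i : 'I_(2 * m)) := mean N (fun x : R => bspline (x / h + (m%:R - i%:R))).
have tf (f : {ffun D -> 'I_(2 * m)}) (a : D) :
    test_function (fun x => bspline (x / h + (m%:R - (f a)%:R))) (c (f a)).
  exact: bspline_test_function.
pose C (f : {ffun D -> 'I_(2 * m)}) := \prod_(a : D) c (f a).
have bumpZ f : mean Q (fun t => @grid_bump R r l m h f (Z t)) = C f.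
  apply: (mean_prod_gaussian (X := fun ij t => Z t ij.1 ij.2)) (tf f) _ => //.
  - by move=> ij A mA; exact: gaussZ.
  - by move=> ij; exact: measurable_bspline_affine.
  - exact: index_enum_uniq.
have bumpX f : (fun n => mean (P n) (fun t => @grid_bump R r l m h f (X n t)))
    @ \oo --> C f.
  apply/cvgrPdist_le => e1 e10.
  have [eps1 eps10 clt] := product_clt p01 (index_enum_uniq D) (tf f) e10.
  have : \forall n \near \oo, eps n.+1 <= eps1.
    move: eps0; rewrite -cvg_shiftS => /cvgrPdist_le/(_ _ eps10).
    apply: filterS => n /=; rewrite sub0r normrN; apply: le_trans; exact: ler_norm.
  move: rho_inj; apply: filterS2 => n rho_inj epsn.
  rewrite distrC; pose v (a : D) := entry_coef (U n) (rho n a.1, a.2).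
  rewrite (mean_mulmx_bernoulli p01 (stdOm n)
    (h := fun A => @grid_bump R r l m h f (rowsub (rho n) A))); last first.
    exact: measurable_grid_bump.
  have -> : Ex p (fun b => @grid_bump R r l m h f
      (rowsub (rho n) (\matrix_(i, j) lin p (entry_coef (U n) (i, j)) b))) =
    Ex p (fun b => \prod_(a : D) bspline (lin p (v a) b / h + (m%:R - (f a)%:R))).
    by apply: eq_Ex => b; apply: eq_bigr => a _; rewrite !mxE.
  apply: clt => [a a'|a k]; last first.
    apply: le_trans (entry_coef_le _ _ _) _.
    exact: le_trans (Ueps _ _ _) epsn.
  (* Injectivity of the row selection makes distinct entries of the selected matrix orthogonal
     forms. *)
  rewrite /v entry_coef_dot// xpair_eqE (inj_eq rho_inj) -xpair_eqE.
  by rewrite -!surjective_pairing.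
have sum_bump (K : {ffun D -> 'I_(2 * m)} -> R) :
    (fun n => \sum_f K f * mean (P n) (fun t => @grid_bump R r l m h f (X n t)))
    @ \oo --> \sum_f K f * C f.
  apply: cvg_big => [|f _]; first exact: add_continuous.
  by apply: cvgM; [exact: cvg_cst|exact: bumpX].
have interpE d1 (T1 : measurableType d1) (P1 : probability T1 R)
    (Y : T1 -> 'M[R]_(r, l)) : random_matrix Y ->
    mean P1 (fun t => @grid_interp R r l m h g (Y t)) =
    \sum_f g (@grid_node R r l m h f) * mean P1 (fun t => @grid_bump R r l m h f (Y t)).
  move=> mY; rewrite mean_sum => [|f].
    by apply: eq_bigr => f _; rewrite meanZ//; exact: measurable_grid_bump.
  by apply: bounded_measurableZ; exact: measurable_grid_bump.
have coverE d1 (T1 : measurableType d1) (P1 : probability T1 R)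
    (Y : T1 -> 'M[R]_(r, l)) : random_matrix Y ->
    mean P1 (fun t => @grid_cover R r l m h (Y t)) =
    \sum_f 1 * mean P1 (fun t => @grid_bump R r l m h f (Y t)).
  move=> mY; rewrite mean_sum => [|f]; last exact: measurable_grid_bump.
  by apply: eq_bigr => f _; rewrite mul1r.
have close d1 (T1 : measurableType d1) (P1 : probability T1 R)
    (Y : T1 -> 'M[R]_(r, l)) : random_matrix Y ->
    `|mean P1 (fun t => g (Y t)) - mean P1 (fun t => @grid_interp R r l m h g (Y t))| <=
    e' + M * (1 - mean P1 (fun t => @grid_cover R r l m h (Y t))).
  move=> mY.
  have bc : bounded_measurable (fun t => @grid_cover R r l m h (Y t)).
    by apply: bounded_measurable_sum => f; exact: measurable_grid_bump.
  have b1 : bounded_measurable (fun t => 1 - @grid_cover R r l m h (Y t)).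
    by apply: bounded_measurableB => //; exact: bounded_measurable_cst.
  have -> : e' + M * (1 - mean P1 (fun t => @grid_cover R r l m h (Y t))) =
      mean P1 (fun t => e' + M * (1 - @grid_cover R r l m h (Y t))).
    rewrite meanD ?mean_cst; last 2 first.
    - exact: bounded_measurable_cst.
    - exact: bounded_measurableZ.
    by rewrite meanZ// meanB ?mean_cst//; exact: bounded_measurable_cst.
  apply: mean_dist => //.
  - exact: measurable_continuous_mx mY cg gM.
  - exact: measurable_grid_interp.
  - apply: bounded_measurableD; first exact: bounded_measurable_cst.
    exact: bounded_measurableZ.
  move=> t; apply: grid_interp_dist => //; first exact: ltW.
  move=> f fY; apply: etag => [i j|i j]; last first.
    by apply: lt_le_trans (grid_bump_near h0 fY i j) heta.
  rewrite mxE normrM gtr0_norm//; apply: le_trans m_hi; rewrite ler_pM2l//.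
  have : (f (i, j))%:R <= 2 * m%:R :> R by rewrite -natrM ler_nat ltnW.
  by rewrite ler_norml => fm; have := ler0n R (f (i, j)); move=> f0; apply/andP; split; lra.
pose tau := \sum_f 1 * C f.
have tauE : tau = \prod_(a : D) \sum_i c i.
  rewrite (bigA_distr_bigA (fun (_ : D) i => c i)).
  by apply: eq_bigr => f _; rewrite mul1r.
have tau_ge : M * (1 - tau) <= e'.
  have c_ge : 1 - 2 * ka <= \sum_i c i.
    have := bspline_grid_mean h0 m_lo; rewrite -/N -/c => h2.
    by apply: le_trans h2; lra.
  have c01 : 0 <= \sum_i c i <= 1.
    have bc i : bounded_measurable (fun x : measurableTypeR R =>
        bspline (x / h + (m%:R - i%:R))).
      by split; [exact: measurable_bspline_affine|exists 1 => x; exact: bspline_norm].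
    have -> : \sum_i c i = mean N (fun x : measurableTypeR R =>
        \sum_(i < 2 * m) bspline (x / h + (m%:R - i%:R))) by rewrite mean_sum.
    apply/andP; split; [rewrite -[leLHS](mean_cst N)|rewrite -[leRHS](mean_cst N)];
      apply: mean_le; try exact: bounded_measurable_cst;
      try exact: bounded_measurable_sum; move=> x;
      by case/andP: (bspline_sum01 m (x / h)).
  have := @prod_ge1B R D (index_enum D) (fun=> \sum_i c i) (fun=> c01).
  rewrite -tauE sumr_const cardT -cardE => tau_ge.
  have k1 : (1 - \sum_i c i) *+ #|{: D}| <= 2 * ka * #|{: D}|%:R.
    by rewrite -mulr_natr ler_wpM2r//; lra.
  apply: (@le_trans _ _ (M * (2 * ka * #|{: D}|%:R))).
    by rewrite ler_wpM2l//; lra.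
  rewrite /ka; have -> : M * (2 * (e' / (2 * (M * #|{: D}|%:R + 1))) * #|{: D}|%:R) =
      e' * (M * #|{: D}|%:R / (M * #|{: D}|%:R + 1)).
    by field; rewrite gt_eqF.
  by rewrite ler_piMr ?(ltW e'0)// ler_pdivrMr// mul1r lerDl.
have M1 : 0 < M + 1 by rewrite ltr_wpDl.
have /cvgrPdist_le/(_ _ e'0) near_interp := sum_bump (fun f => g (@grid_node R r l m h f)).
have /cvgrPdist_le/(_ _ (divr_gt0 e'0 M1)) near_cover := sum_bump (fun=> 1).
apply: filterS2 near_interp near_cover => n.
rewrite -(interpE _ _ _ _ (mX n)) -(coverE _ _ _ _ (mX n)) -/tau => ni nc.
have cX := close _ _ (P n) _ (mX n); have cZ := close _ _ Q _ mZ.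
rewrite (interpE _ _ _ _ mZ) (coverE _ _ _ _ mZ) in cZ.
rewrite (eq_bigr (fun f => g (@grid_node R r l m h f) * C f)) in cZ; last first.
  by move=> f _; rewrite bumpZ.
rewrite (_ : \sum_f 1 * mean Q _ = tau) in cZ; last first.
  by apply: eq_bigr => f _; rewrite bumpZ.
(* Tightness of the laws of [X n]: the mass they put on the grid is eventually almost the Gaussian
   mass [tau]. *)
have ncM : M * (tau - mean (P n) (fun t => @grid_cover R r l m h (X n t))) <= e'.
  apply: (@le_trans _ _ (M * (e' / (M + 1)))).
    by rewrite ler_wpM2l//; apply: le_trans nc; exact: ler_norm.
  by rewrite mulrCA ler_piMr ?(ltW e'0)// ler_pdivrMr// mul1r lerDl.
have -> : e = 8 * e' by rewrite /e'; field.
rewrite /=; move: cX cZ ni; rewrite !ler_norml => /andP[? ?] /andP[? ?] /andP[? ?].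
by apply/andP; split; lra.
Unshelve. all: by end_near. Qed.

Theorem theorem1 (R : realType) (p : R) (p01 : 0 < p < 1) :
  exists C : R,
  forall (l : nat) (d : nat -> measure_display)
    (T : forall n, measurableType (d n)) (P : forall n, probability (T n) R)
    (Om : forall n, T n -> 'M[R]_(n.+1, l))
    (U : forall n, 'M[R]_n.+1) (eps : nat -> R),
  (forall n, standardized_bernoulli_matrix (P n) p (Om n)) ->
  (forall n, orthogonal_matrix (U n)) ->
  (forall n i j, `|U n i j| <= eps n.+1) ->
  eps @ \oo --> (0 : R) ->
  cvg_to_standard_gaussian P (fun n t => U n *m Om n t) /\
  (forall n (i : 'I_n.+1) (j : 'I_l),
    (kolmogorov_distance
       (fun x : R => P n [set t | ((U n *m Om n t) i j <= x)%R])
       (@std_normal_cdf R)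
     <= (C * \sum_(k < n.+1) `|U n i k| ^+ 3)%:E)%E).
Proof.
exists ((5 + @stein_bound R) / bern_sd p) => l d T P Om U eps stdOm orthU Ueps eps0.
split; first exact: (cvg_standardized_bernoulli p01 stdOm orthU Ueps eps0).
by move=> n i j; exact: berry_esseen_entry.
Qed.
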